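(* Let $m\ge 2$, let $f\in\mathbb{R}^{d_1\times\cdots\times d_m}$ be a nonnegative weakly irreducible tensor and let $1<p_1,\ldots,p_m<\infty$ be such that there exists $i\in[m]$ with $$m-1\le (p_i-1)\Big(\min_{k\in[m]\setminus\{i\}}p_k-(m-1)\Big).$$ Then there exists a unique vector $\mathbf x^*\in\mathcal S^d_{++}$ such that $Q(\mathbf x^* )=\|f\|_{p_1,\ldots,p_m}$. Furthermore, $$\max_{\mathbf x\in\mathcal S^d_{++}}\ \prod_{\nu\in[m]\setminus\{i\}}\ \min_{j_\nu\in[d_\nu]}\Big(\frac{s_{i,\nu,j_\nu}(\mathbf x)}{x_{\nu,j_\nu}}\Big)^{p_\nu-1}=\|f\|_{p_1,\ldots,p_m}^{p_i'(m-1)}=\min_{\mathbf x\in\mathcal S^d_{++}}\ \prod_{\nu\in[m]\setminus\{i\}}\ \max_{j_\nu\in[d_\nu]}\Big(\frac{s_{i,\nu,j_\nu}(\mathbf x)}{x_{\nu,j_\nu}}\Big)^{p_\nu-1},$$ and if $f$ is irreducible then $\mathbf x^*>0$ is the unique nonnegative $\ell^{p_1,\ldots,p_m}$ singular vector of $f$, up to scale.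
   Context: $[n]=\{1,\dots,n\}$. A tensor $f\in\mathbb{R}^{d_1\times\cdots\times d_m}$ is identified with the multilinear form $f(\mathbf x_1,\ldots,\mathbf x_m)=\sum_{j_1\in[d_1],\ldots,j_m\in[d_m]}f_{j_1,\ldots,j_m}x_{1,j_1}\cdots x_{m,j_m}$ on $\mathcal R^d:=\mathbb{R}^{d_1}\times\cdots\times\mathbb{R}^{d_m}$, with $\mathbf x=(\mathbf x_1,\dots,\mathbf x_m)$, $\mathbf x_k=(x_{k,1},\dots,x_{k,d_k})$. Inequalities are entrywise ($f\ge0$: all entries nonnegative; $\mathbf x>0$: all entries positive). For $1<p<\infty$, $p'=p/(p-1)$. For $1<q<\infty$, $\psi_q:\mathbb{R}^n\to\mathbb{R}^n$, $(\psi_q(\mathbf y))_j=|y_j|^{q-1}\mathrm{sign}(y_j)$. $Q(\mathbf x)=|f(\mathbf x)|/(\|\mathbf x_1\|_{p_1}\cdots\|\mathbf x_m\|_{p_m})$ and $\|f\|_{p_1,\ldots,p_m}=\max Q$ over $\mathbf x$ with all $\mathbf x_k\neq0$. $\mathcal S^d_{++}=\{\mathbf x\in\mathcal R^d:\mathbf x>0,\ \|\mathbf x_k\|_{p_k}=1\ \forall k\}$. An $\ell^{p_1,\ldots,p_m}$ singular vector of $f$ is a critical point $\mathbf x$ of $Q$ with all $\mathbf x_k\ne0$ and $f(\mathbf x)\neq 0$ (singular value $Q(\mathbf x)$). $\partial_{k,j_k}=\partial/\partial x_{k,j_k}$, $\nabla_k f(\mathbf x)=(\partial_{k,1}f(\mathbf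 x),\dots,\partial_{k,d_k}f(\mathbf x))$. For $k\ne i$ and $j_k\in[d_k]$: $s_{i,k,j_k}(\mathbf x)=\psi_{p_k'}\big(\sum_{j_i\in[d_i]}\psi_{p_i'}(\partial_{i,j_i}f(\mathbf x))\,\partial_{i,j_i}\partial_{k,j_k}f(\mathbf x)\big)$ (this does not depend on $\mathbf x_i$). Weak irreducibility: let $G(f)$ be the undirected graph on vertices $V=\bigcup_{k\in[m]}\{k\}\times[d_k]$ where $(k,j_k),(l,j_l)$ with $k\ne l$ are adjacent iff there exist $j_\nu\in[d_\nu]$, $\nu\notin\{k,l\}$, with $f_{j_1,\ldots,j_m}>0$; $f\ge0$ is weakly irreducible if $G(f)$ is connected. Irreducibility: $f\ge0$ is irreducible if for every nonempty proper $J\subsetneq V$, with $I=V\setminus J$, there exist $(k,j_k)\in J$ and $(l,j_l)\in I$ for all $l\in[m]\setminus\{k\}$ with $f_{j_1,\ldots,j_m}>0$. *)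

(* Defs.v *)
From HB Require Import structures.
From mathcomp Require Import all_boot all_order all_algebra.
From mathcomp Require Import all_classical all_reals all_analysis.
Set Implicit Arguments. Unset Strict Implicit. Unset Printing Implicit Defensive.
Import Order.TTheory GRing.Theory Num.Theory.
Local Open Scope ring_scope.
Local Open Scope classical_set_scope.

Section TensorDefs.
Variables (R : realType) (m : nat) (d : 'I_m -> nat).

Definition midx := {dffun forall k : 'I_m, 'I_(d k)}.
Definition tensor := midx -> R.
Definition pt := forall k : 'I_m, 'I_(d k) -> R.

Definition mform (f : tensor) (x : pt) : R :=
  \sum_(J : midx) f J * \prod_(k < m) x k (J k).

Definition pnorm (p : R) (n : nat) (v : 'I_n -> R) : R :=
  (\sum_(j < n) `|v j| `^ p) `^ (p^-1).

Definition conj_exp (p : R) : R := p / (p - 1).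

Definition psi (q : R) (y : R) : R := Num.sg y * `|y| `^ (q - 1).

Definition shift (x : pt) (k0 : 'I_m) (j0 : nat) (t : R) : pt :=
  fun k j => x k j + (if (k == k0) && (val j == j0) then t else 0).

Definition pderiv (g : pt -> R) (k : 'I_m) (j : nat) (x : pt) : R :=
  derive1 (fun t => g (shift x k j t)) 0.

Definition Qf (f : tensor) (p : 'I_m -> R) (x : pt) : R :=
  `|mform f x| / \prod_(k < m) pnorm (p k) (x k).

Definition admissible (x : pt) : Prop := forall k, exists j, x k j != 0.

(* ||f||_{p_1,...,p_m} = max Q over admissible x (written as sup) *)
Definition tnorm (f : tensor) (p : 'I_m -> R) : R :=
  sup [set Qf f p x | x in admissible].

Definition Spp (p : 'I_m -> R) (x : pt) : Prop :=
  (forall k j, 0 < x k j) /\ (forall k, pnorm (p k) (x k) = 1).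

Definition singular_vector (f : tensor) (p : 'I_m -> R) (x : pt) : Prop :=
  admissible x /\ mform f x != 0 /\
  forall (k : 'I_m) (j : 'I_(d k)),
    derivable (fun t => Qf f p (shift x k j t)) 0 1 /\
    pderiv (Qf f p) k j x = 0.

Definition sfun (f : tensor) (p : 'I_m -> R) (i k : 'I_m) (jk : 'I_(d k)) (x : pt) : R :=
  psi (conj_exp (p k))
    (\sum_(ji < d i) psi (conj_exp (p i)) (pderiv (mform f) i ji x)
         * pderiv (pderiv (mform f) k jk) i ji x).

Definition vert := {k : 'I_m & 'I_(d k)}.

Definition gadj (f : tensor) : rel vert :=
  fun u v => (tag u != tag v) &&
    [exists J : midx, (J (tag u) == tagged u) && (J (tag v) == tagged v) && (0 < f J)].

Definition nonneg_tensor (f : tensor) : Prop := forall J, 0 <= f J.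

Definition weakly_irreducible (f : tensor) : Prop :=
  nonneg_tensor f /\ forall u v : vert, connect (gadj f) u v.

Definition irreducible (f : tensor) : Prop :=
  nonneg_tensor f /\
  forall Jset : {set vert}, Jset != finset.set0 -> Jset != finset.setTfor vert ->
    exists u, u \in Jset /\ exists J : midx,
      J (tag u) = tagged u /\ 0 < f J /\
      forall l : 'I_m, l != tag u ->
        (Tagged (fun k => 'I_(d k)) (J l)) \notin Jset.

Definition minp_except (p : 'I_m -> R) (i : 'I_m) : R :=
  inf [set p k | k in [set k | k != i]].

Definition CW_lower (f : tensor) (p : 'I_m -> R) (i : 'I_m) (x : pt) : R :=
  \prod_(nu < m | nu != i)
     inf (range (fun j : 'I_(d nu) => (sfun f p i j x / x nu j) `^ (p nu - 1))).

Definition CW_upper (f : tensor) (p : 'I_m -> R) (i : 'I_m) (x : pt) : R :=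
  \prod_(nu < m | nu != i)
     sup (range (fun j : 'I_(d nu) => (sfun f p i j x / x nu j) `^ (p nu - 1))).

End TensorDefs.

(* Main.v *)
Require Import Defs.
From HB Require Import structures.
From mathcomp Require Import all_boot all_order all_algebra.
From mathcomp Require Import all_classical all_reals all_analysis.
From mathcomp Require Import ring lra.
Import Order.TTheory GRing.Theory Num.Theory.
Import numFieldNormedType.Exports.
Set Implicit Arguments. Unset Strict Implicit. Unset Printing Implicit Defensive.
Local Open Scope ring_scope.
Local Open Scope classical_set_scope.

(** The hypothesis says [p_i' (m - 1) <= p_k] for all [k <> i], whence
    [\sum_k 1 / p_k <= 1].  Under this condition Hölder's inequality, for the
    weights [f_J x^J / f(x)] and the functions [y_k / x_k], shows that a positive
    critical point [x] of [Q] maximizes [Q]; its equality case makes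
    [(y_k / x_k) ^ p_k] constant along each index of the support of [f], hence
    everywhere when the graph of [f] is connected, so the maximizer is unique.  A
    maximizer exists by compactness, and it is positive because raising its zero
    entries to [e ^ (1 / p_k)] gains [e ^ a] with [a < 1] and loses only [O(e)].

    For the Collatz-Wielandt formula, replace the block [i] of [x] by the maximizer
    of the linear form it is paired with, and let [g] be the resulting value of
    [f].  Each min is at most [g] and each max is at least [g] by Euler's identity;
    [g <= ||f|| ^ p_i'] gives the lower bound, and Hölder's inequality from this
    point to the maximizer of [Q] gives the upper one. *)

(** * Weighted AM-GM inequality with its equality case *)

Section Inequalities.
Variable R : realType.

Lemma powRV (a r : R) : 0 <= a -> a^-1 `^ r = (a `^ r)^-1.
Proof. by move=> a0; rewrite -powR_inv1 // powRAC powR_inv1 ?powR_ge0. Qed.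

(** The missing weight [1 - \sum_k a k] is given to a phantom factor [1], which makes this AM-GM for
    total weight one. The exponential lies above its tangent at the logarithm [L] of the product,
    strictly so away from [L]; equality therefore forces [ln (w k) = L]. *)
Lemma weighted_amgm_powR (I : finType) (a w : I -> R) :
    (forall k, 0 < a k) -> \sum_k a k <= 1 -> (forall k, 0 < w k) ->
    let A := \sum_k a k * w k + (1 - \sum_k a k) in
  \prod_k w k `^ a k <= A /\ (\prod_k w k `^ a k = A -> forall k, w k = A).
Proof.
move=> a0 sa w0 A.
set L := \sum_k a k * ln (w k); set T := expR L.
have prodE : \prod_k w k `^ a k = T.
  rewrite /T /L expR_sum; apply: eq_bigr => k _.
  by rewrite /powR gt_eqF.
have wT k : w k = T * expR (ln (w k) - L).
  by rewrite -expRD addrC subrK lnK // posrE.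
(* The tangent values average exactly to [T], because [L] is the weighted mean of the logarithms,
   the phantom factor contributing [0]. *)
have AT : A - T = \sum_k a k * (w k - T * (1 + ln (w k) - L))
                  + (1 - \sum_k a k) * (1 - T * (1 - L)).
  have -> : \sum_k a k * (w k - T * (1 + ln (w k) - L)) =
      \sum_k a k * w k - T * (1 - L) * \sum_k a k - T * L.
    rewrite /L mulr_sumr [X in _ = _ - X - _]mulr_sumr -!sumrB.
    by apply: eq_bigr => k _; rewrite -/L; ring.
  rewrite /A; ring.
have T0 : 0 < T by exact: expR_gt0.
have term_ge0 k : 0 <= a k * (w k - T * (1 + ln (w k) - L)).
  rewrite mulr_ge0 ?(ltW (a0 k)) // subr_ge0 [leRHS]wT ler_pM2l //.
  by rewrite -addrA expR_ge1Dx.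
have rest_ge0 : 0 <= (1 - \sum_k a k) * (1 - T * (1 - L)).
  rewrite mulr_ge0 ?[0 <= 1 - \sum__ _]subr_ge0 //.
  rewrite [X in X - _](_ : 1 = T * expR (- L)); last by rewrite -expRD subrr expR0.
  by rewrite subr_ge0 ler_pM2l // expR_ge1Dx.
have sum_ge0 : 0 <= \sum_k a k * (w k - T * (1 + ln (w k) - L)).
  by apply: sumr_ge0.
rewrite prodE; split; first by rewrite -subr_ge0 AT addr_ge0.
move=> TA k; have /eqP : A - T = 0 by rewrite TA subrr.
rewrite AT paddr_eq0 // => /andP[/eqP s0 _].
have /eqP := psumr_eq0P (fun k _ => term_ge0 k) s0 (i:=k) isT.
rewrite mulf_eq0 gt_eqF //= subr_eq0 => /eqP wk.
rewrite -TA [w k]wT; have [->|ne] := eqVneq (ln (w k) - L) 0.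
  by rewrite expR0 mulr1.
have := expR_gt1Dx ne; rewrite addrA -(ltr_pM2l T0) -wk -wT.
by rewrite ltxx.
Qed.

Lemma derive1_affine (c D t : R) : (fun u => c + u * D)^`() t = D.
Proof.
have h : is_derive t 1 (cst c + D \*: id : R -> R) (0 + D *: 1) by exact: is_deriveD.
have -> : (fun u => c + u * D) = (cst c + D \*: id : R -> R).
  by apply: funext => u; rewrite /= mulrC.
by rewrite derive1E (@derive_val _ _ _ _ _ _ _ h) add0r [LHS]mulr1.
Qed.

End Inequalities.

(** * Multilinear forms and their partial derivatives *)

Section Blocks.
Variables (R : realType) (m : nat) (d : 'I_m -> nat).

(** The new block comes inside a whole point [a], so that no transport along [l = k] is needed in
    the dependent family of blocks. *)
Definition replace_block (x : pt R d) (k : 'I_m) (a : pt R d) : pt R d :=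
  fun l j => if l == k then a l j else x l j.

(** A standard basis vector in every block at once; [replace_block] picks the block that matters. *)
Definition unit_block (j0 : nat) : pt R d := fun _ j => (val j == j0)%:R.

End Blocks.
Arguments replace_block {R m d} x k a _ _.
Arguments unit_block {R m d} j0 _ _.

Section Multilinear.
Variables (R : realType) (m : nat) (d : 'I_m -> nat).
Variable f : tensor R d.
Implicit Types (x y a b : pt R d) (k l : 'I_m).

(** The algebraic form of the partial derivative: a form linear in block [k] is differentiated by
    inserting a basis vector there. *)
Definition mpartial k (j : nat) x : R := mform f (replace_block x k (unit_block j)).

Lemma prod_replace_block x k a (J : midx d) :
  \prod_(l < m) replace_block x k a l (J l) = a k (J k) * \prod_(l < m | l != k) x l (J l).
Proof.
rewrite (bigD1 k) //= /replace_block eqxx; congr (_ * _).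
by apply: eq_bigr => l /negbTE ->.
Qed.

Lemma eq_mform x y : (forall k j, x k j = y k j) -> mform f x = mform f y.
Proof.
by move=> xy; apply: eq_bigr => J _; congr (_ * _); apply: eq_bigr => k _.
Qed.

Lemma mform_shift x k (j : nat) t :
  mform f (Defs.shift x k j t) = mform f x + t * mpartial k j x.
Proof.
rewrite /mpartial /mform mulr_sumr -big_split; apply: eq_bigr => J _ /=.
rewrite prod_replace_block /unit_block [X in _ = _ * X + _](bigD1 k) //=.
rewrite (bigD1 k) //= /Defs.shift eqxx /=.
under eq_bigr => l lk do rewrite (negbTE lk) /= addr0.
by case: eqP => _ /=; ring.
Qed.

Lemma pderiv_mform k (j : nat) : pderiv (mform f) k j = mpartial k j.
Proof.
apply: funext => x; rewrite /pderiv.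
have -> : (fun t => mform f (Defs.shift x k j t)) =
    (fun t => mform f x + t * mpartial k j x).
  by apply: funext => t; rewrite mform_shift.
exact: derive1_affine.
Qed.

Lemma pderiv_mpartial k (j : nat) i (ji : nat) x : k != i ->
  pderiv (mpartial k j) i ji x = mpartial i ji (replace_block x k (unit_block j)).
Proof.
move=> ki; transitivity (pderiv (mform f) i ji (replace_block x k (unit_block j)));
  last by rewrite pderiv_mform.
rewrite /pderiv.
suff -> : (fun t => mpartial k j (Defs.shift x i ji t)) =
  (fun t => mform f (Defs.shift (replace_block x k (unit_block j)) i ji t)) by [].
apply: funext => t; apply: eq_mform => l u.
rewrite /replace_block /Defs.shift; case: (eqVneq l k) => [lk|//].
by rewrite [l == i](_ : _ = false) /= ?addr0 // lk (negbTE ki).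
Qed.

Lemma mform_replace_block x k a :
  mform f (replace_block x k a) = \sum_(j < d k) a k j * mpartial k j x.
Proof.
under [RHS]eq_bigr do rewrite mulr_sumr.
rewrite exchange_big; apply: eq_bigr => J _ /=.
rewrite [RHS](bigD1 (J k)) //= [X in _ = _ + X]big1 ?addr0 => [|j jJ].
  by rewrite !prod_replace_block /unit_block eqxx /=; ring.
rewrite prod_replace_block /unit_block -[val _ == _]/(J k == j) eq_sym (negbTE jJ).
by rewrite !(mul0r, mulr0).
Qed.

Lemma euler_mform x k : \sum_(j < d k) x k j * mpartial k j x = mform f x.
Proof.
rewrite -mform_replace_block; apply: eq_mform => l j.
by rewrite /replace_block if_same.
Qed.

(** Substitutions in two different blocks commute. This collapses the sum of second derivatives
    inside [sfun] to a single first derivative. *)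
Lemma mpartial_replace_block x k (j : nat) i a : k != i ->
  \sum_(ji < d i) a i ji * mpartial i ji (replace_block x k (unit_block j)) =
  mpartial k j (replace_block x i a).
Proof.
move=> ki; rewrite -mform_replace_block; apply: eq_mform => l u.
rewrite /replace_block; case: (eqVneq l k) => [lk|//].
by rewrite [l == i](_ : _ = false) // lk (negbTE ki).
Qed.

Lemma eq_mpartial k (j : nat) x y :
  (forall l u, l != k -> x l u = y l u) -> mpartial k j x = mpartial k j y.
Proof.
move=> xy; apply: eq_mform => l u; rewrite /replace_block.
by case: eqVneq => // /xy.
Qed.

Lemma mform_scale (c : 'I_m -> R) x :
  mform f (fun k j => c k * x k j) = (\prod_(k < m) c k) * mform f x.
Proof.
rewrite /mform mulr_sumr; apply: eq_bigr => J _.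
by rewrite big_split /=; ring.
Qed.

Hypothesis f_ge0 : nonneg_tensor f.

Lemma mform_ge0 x : (forall k j, 0 <= x k j) -> 0 <= mform f x.
Proof. by move=> x0; apply: sumr_ge0 => J _; rewrite mulr_ge0 ?prodr_ge0. Qed.

Lemma mform_gt0 x (J : midx d) : (forall k j, 0 <= x k j) ->
  0 < f J -> (forall k, 0 < x k (J k)) -> 0 < mform f x.
Proof.
move=> x0 fJ xJ; rewrite /mform (bigD1 J) //= ltr_wpDr //.
  by apply: sumr_ge0 => J' _; rewrite mulr_ge0 ?prodr_ge0.
by rewrite mulr_gt0 ?prodr_gt0.
Qed.

Lemma mpartial_gt0 x k (J : midx d) : (forall l j, 0 <= x l j) ->
  0 < f J -> (forall l, l != k -> 0 < x l (J l)) -> 0 < mpartial k (J k) x.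
Proof.
move=> x0 fJ xJ; apply: (@mform_gt0 _ J) => // [l j|l]; rewrite /replace_block.
  by case: eqP => // _; rewrite ler0n.
by case: (eqVneq l k) => [lk|/xJ//]; rewrite /unit_block lk eqxx.
Qed.

Lemma ler_norm_mform x : `|mform f x| <= mform f (fun k j => `|x k j|).
Proof.
apply: (le_trans (ler_norm_sum _ _ _)); apply: ler_sum => J _.
by rewrite normrM normr_prod ger0_norm.
Qed.

(** * Hölder's inequality for the multilinear form *)

Section Hoelder.
Variable p : 'I_m -> R.
Hypothesis p_gt0 : forall k, 0 < p k.
Hypothesis sum_p : \sum_(k < m) (p k)^-1 <= 1.

(* Hölder's inequality for the probability weights [f J * x^J / f(x)], applied
   to the quotients [y / x]; [E] collects the moments of order [p k]. *)
Lemma hoelder_mform x y (E : 'I_m -> R) :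
    (forall k j, 0 < x k j) -> (forall k j, 0 < y k j) -> (forall k, 0 < E k) ->
    (forall k, \sum_(j < d k) (y k j / x k j) `^ p k * (x k j * mpartial k j x)
       <= E k * mform f x) ->
  mform f y <= mform f x * \prod_(k < m) E k `^ (p k)^-1 /\
  (mform f y = mform f x * \prod_(k < m) E k `^ (p k)^-1 ->
   forall J, 0 < f J -> forall k l,
     (y k (J k) / x k (J k)) `^ p k / E k = (y l (J l) / x l (J l)) `^ p l / E l).
Proof.
move=> x0 y0 E0 hE.
pose w k (j : 'I_(d k)) := (y k j / x k j) `^ p k / E k.
pose A (J : midx d) := \sum_(k < m) (p k)^-1 * w k (J k) + (1 - \sum_(k < m) (p k)^-1).
set C := \prod_(k < m) E k `^ (p k)^-1.
have C0 : 0 < C by apply: prodr_gt0 => k _; exact: powR_gt0.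
have w0 k j : 0 < w k j by rewrite divr_gt0 // powR_gt0 // divr_gt0.
have pV0 k : 0 < (p k)^-1 by rewrite invr_gt0.
have amgm J := weighted_amgm_powR pV0 sum_p (fun k => w0 k (J k)).
(* The exponents [(p k)^-1] undo the powers [p k] in [w], and [C] restores the normalizations
   [E k]. *)
have prodw (J : midx d) :
    C * ((\prod_(k < m) x k (J k)) * \prod_(k < m) w k (J k) `^ (p k)^-1) = \prod_(k < m) y k (J k).
  rewrite -!big_split; apply: eq_bigr => k _ /=.
  rewrite /w powRM ?powR_ge0 ?invr_ge0 ?(ltW (E0 k)) //.
  rewrite -powRrM divff ?gt_eqF // powRr1 ?divr_ge0 ?ltW //.
  rewrite [(E k)^-1 `^ _]powRV ?ltW //.
  have := powR_gt0 (p k)^-1 (E0 k); have := x0 k (J k).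
  by move=> /lt0r_neq0 xn /lt0r_neq0 En; field; rewrite En xn.
(* Averaged over the support, the [k]-th normalized moment is at most [f(x)] by [hE], and the
   weights of [A] add up to one. *)
have sumA : \sum_J f J * (\prod_(k < m) x k (J k)) * A J <= mform f x.
  have -> : \sum_J f J * (\prod_(k < m) x k (J k)) * A J =
      \sum_(k < m) (p k)^-1 * ((\sum_(j < d k) (y k j / x k j) `^ p k *
         (x k j * mpartial k j x)) / E k) + (1 - \sum_(k < m) (p k)^-1) * mform f x.
    under eq_bigr do rewrite /A mulrDr.
    rewrite big_split /=; congr (_ + _); last first.
      by rewrite /mform mulr_sumr; apply: eq_bigr => J _; rewrite mulrC.
    under eq_bigr do rewrite mulr_sumr.
    rewrite exchange_big /=; apply: eq_bigr => k _.
    have -> : \sum_(j < d k) (y k j / x k j) `^ p k * (x k j * mpartial k j x) =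
      mform f (replace_block x k (fun l j => (y l j / x l j) `^ p l * x l j)).
      by rewrite mform_replace_block; apply: eq_bigr => j _; rewrite mulrA.
    rewrite /mform mulr_suml mulr_sumr; apply: eq_bigr => J _.
    by rewrite prod_replace_block /w (bigD1 k) //=; ring.
  rewrite [leRHS](_ : _ = (\sum_(k < m) (p k)^-1 + (1 - \sum_(k < m) (p k)^-1)) * mform f x).
    rewrite [leRHS]mulrDl lerD2r mulr_suml; apply: ler_sum => k _.
    by rewrite ler_pM2l // ler_pdivrMr // mulrC.
  by rewrite addrC subrK mul1r.
have yE : mform f y =
    C * \sum_J f J * (\prod_(k < m) x k (J k)) * \prod_(k < m) w k (J k) `^ (p k)^-1.
  by rewrite /mform mulr_sumr; apply: eq_bigr => J _; rewrite -prodw; ring.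
have term_ge0 J : 0 <= f J * (\prod_(k < m) x k (J k)) *
    (A J - \prod_(k < m) w k (J k) `^ (p k)^-1).
  rewrite mulr_ge0 ?subr_ge0 ?(proj1 (amgm J)) // mulr_ge0 //.
  by apply: prodr_ge0 => k _; exact: ltW.
have diffE : \sum_J f J * (\prod_(k < m) x k (J k)) * A J -
   \sum_J f J * (\prod_(k < m) x k (J k)) * \prod_(k < m) w k (J k) `^ (p k)^-1 =
   \sum_J f J * (\prod_(k < m) x k (J k)) * (A J - \prod_(k < m) w k (J k) `^ (p k)^-1).
  by rewrite -sumrB; apply: eq_bigr => J _; rewrite mulrBr.
have le_sum : \sum_J f J * (\prod_(k < m) x k (J k)) * \prod_(k < m) w k (J k) `^ (p k)^-1
    <= \sum_J f J * (\prod_(k < m) x k (J k)) * A J.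
  by rewrite -subr_ge0 diffE; apply: sumr_ge0.
split; first by rewrite yE mulrC ler_pM2r // (le_trans le_sum).
(* Equality makes a sum of nonnegative AM-GM gaps vanish. On the support each gap carries a positive
   weight, so every [w k (J k)] equals [A J]. *)
rewrite yE [RHS]mulrC => /(mulfI (lt0r_neq0 C0)) eqx J fJ k l.
have s0 : \sum_J f J * (\prod_(k < m) x k (J k)) *
    (A J - \prod_(k < m) w k (J k) `^ (p k)^-1) = 0.
  apply/eqP; rewrite eq_le sumr_ge0 // andbT -diffE subr_le0.
  by rewrite eqx.
have /eqP := psumr_eq0P (fun J _ => term_ge0 J) s0 (i:=J) isT.
rewrite mulf_eq0 gt_eqF /=; last by rewrite mulr_gt0 // prodr_gt0.
rewrite subr_eq0 => /eqP /esym /(proj2 (amgm J)) wA.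
by rewrite -/(w k (J k)) -/(w l (J l)) !wA.
Qed.

End Hoelder.
End Multilinear.

(** * Derivatives and continuity along one coordinate *)

Section Calculus.
Variable R : realType.

(** At [0] the difference quotient has modulus [|h| ^ (p - 1)], which tends to [0]. Including [0]
    allows for zero entries of nonnegative points. *)
Lemma is_derive_abs_powR (p s : R) : 1 < p -> 0 <= s ->
  is_derive s 1 (fun u => `|u| `^ p) (p * s `^ (p - 1)).
Proof.
move=> p1; rewrite le_eqVlt => /predU1P[<-|s0]; last first.
  apply: near_eq_is_derive (is_derive1_powR p s0).
  by near=> u; rewrite ger0_norm // ltW //; near: u; exact: lt_nbhsr.
have p0 : p - 1 != 0 by rewrite subr_eq0 gt_eqF.
have pp : 0 < p - 1 by rewrite subr_gt0.
rewrite powR0 // mulr0.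
have cvg0 : h^-1 *: (`|h *: (1:R) + 0| `^ p - `|0 : R| `^ p) @[h --> 0^'] --> (0 : R).
  apply/cvgrPdist_lt => e e0; near=> h.
  have h0 : h != 0 by near: h; exact: nbhs_dnbhs_neq.
  rewrite sub0r normrN normr0 powR0 ?gt_eqF ?(lt_trans ltr01) //.
  rewrite subr0 addr0 [h *: _]mulr1 normrM normfV [`|_ `^ p|]ger0_norm ?powR_ge0 //.
  rewrite -mulr_powRB1 ?(lt_trans ltr01) // mulKf ?normr_eq0 //.
  (* This gives the tolerance [e ^ (1 / (p - 1))] for [|h|]. *)
  rewrite [ltRHS](_ : e = (e `^ (p - 1)^-1) `^ (p - 1)); last first.
    by rewrite -powRrM mulVf // powRr1 // ltW.
  rewrite gt0_ltr_powR // ?nnegrE ?powR_ge0 //.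
  near: h; apply: dnbhs0_lt; exact: powR_gt0.
apply: DeriveDef; first by apply/cvg_ex; exists 0.
exact: cvg_lim cvg0.
Unshelve. all: by end_near. Qed.

Lemma continuous_abs_powR (p : R) : 1 < p -> continuous (fun u : R => `|u| `^ p).
Proof.
move=> p1 s.
have pos t : 0 <= t -> {for t, continuous (fun u : R => `|u| `^ p)}.
  move=> /(is_derive_abs_powR p1) h.
  by apply/differentiable_continuous/derivable1_diffP.
have [/pos//|/ltW s0] := leP 0 s.
rewrite (_ : (fun u : R => _) = (fun u => `|u| `^ p) \o -%R); last first.
  by apply: funext => u /=; rewrite normrN.
apply: continuous_comp; first exact: opp_continuous.
by apply: pos; rewrite oppr_ge0.
Qed.

(* The profile of the Rayleigh quotient along one coordinate axis. *)
Lemma is_derive_quotient (p P a C c D t : R) :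
    1 < p -> 0 < P -> 0 <= a + t -> 0 < C + `|a + t| `^ p -> 0 < c + t * D ->
    let N := (C + `|a + t| `^ p) `^ p^-1 in
  is_derive t 1 (fun u => `|c + u * D| / (P * (C + `|a + u| `^ p) `^ p^-1))
   ((D - (c + t * D) * (a + t) `^ (p - 1) / (C + `|a + t| `^ p)) / (P * N)).
Proof.
move=> p1 P0 at0 S0 cD0 N.
have p0 : 0 < p by rewrite (lt_trans ltr01).
have da : is_derive t 1 (fun u => a + u) 1.
  have h : is_derive t 1 (cst a + id : R -> R) (0 + 1) by exact: is_deriveD.
  by move: h; rewrite add0r.
have dpow : is_derive t 1 (fun u => `|a + u| `^ p) (p * (a + t) `^ (p - 1)).
  have := is_derive1_comp (is_derive_abs_powR p1 at0) da.
  by rewrite mulr1.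
have dS : is_derive t 1 (fun u => C + `|a + u| `^ p) (p * (a + t) `^ (p - 1)).
  have h : is_derive t 1 (cst C + (fun u => `|a + u| `^ p) : R -> R)
      (0 + p * (a + t) `^ (p - 1)) by exact: is_deriveD.
  by move: h; rewrite add0r.
have dN := @is_derive1_comp R (fun z : R => z `^ p^-1) (fun u => C + `|a + u| `^ p) t _ _
  (is_derive1_powR p^-1 S0) dS.
have dPN := is_deriveZ P dN.
have N0 : 0 < N by exact: powR_gt0.
have PN0 : (P \*: ((fun z => z `^ p^-1) \o (fun u => C + `|a + u| `^ p))) t != 0.
  by rewrite /= gt_eqF // mulr_gt0.
have dV := is_deriveV PN0 dPN.
have dlin : is_derive t 1 (fun u => c + u * D) D.
  have h : is_derive t 1 (cst c + D \*: id : R -> R) (0 + D *: 1).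
    exact: is_deriveD.
  move: h; rewrite add0r [_ *: 1]mulr1.
  by apply: near_eq_is_derive; near=> u; rewrite /= mulrC.
have dnum : is_derive t 1 (fun u => `|c + u * D|) D.
  apply: near_eq_is_derive (dlin); near=> u; rewrite ger0_norm // ltW //.
  near: u.
  have ct : {for t, continuous (fun u : R => c + u * D)}.
    by apply/differentiable_continuous/derivable1_diffP.
  exact: (ct _ (lt_nbhsr cD0)).
have := is_deriveM dnum dV.
rewrite /= -/N => h; apply: is_derive_eq h _.
rewrite /GRing.scale /= gtr0_norm //.
have -> : (C + `|a + t| `^ p) `^ (p^-1 - 1) = N / (C + `|a + t| `^ p).
  by rewrite powRB ?powRr1 ?(ltW S0) //; apply/implyP => _; rewrite gt_eqF.
move: S0; set S := C + _ => S0.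
by field; rewrite !gt_eqF.
Unshelve. all: by end_near. Qed.

Lemma continuous_sum_fun (T : topologicalType) (I : Type) (s : seq I) (F : I -> T -> R) :
  (forall i, continuous (F i)) -> continuous (fun x => \sum_(i <- s) F i x).
Proof.
move=> cF; elim: s => [|i s IH].
  by rewrite (_ : (fun x => _) = cst 0);
    [exact: cst_continuous | apply: funext => x; rewrite big_nil].
rewrite (_ : (fun x => _) = (fun x => F i x + \sum_(j <- s) F j x)).
  by move=> x; apply: continuousD; [exact: cF | exact: IH].
by apply: funext => x; rewrite big_cons.
Qed.

Lemma continuous_prod_fun (T : topologicalType) (I : Type) (s : seq I) (F : I -> T -> R) :
  (forall i, continuous (F i)) -> continuous (fun x => \prod_(i <- s) F i x).
Proof.
move=> cF; elim: s => [|i s IH].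
  by rewrite (_ : (fun x => _) = cst 1);
    [exact: cst_continuous | apply: funext => x; rewrite big_nil].
rewrite (_ : (fun x => _) = (fun x => F i x * \prod_(j <- s) F j x)).
  by move=> x; apply: continuousM; [exact: cF | exact: IH].
by apply: funext => x; rewrite big_cons.
Qed.

End Calculus.

Arguments Defs.shift {R m d} x k0 j0 t _ _.

(** * Elementary properties of the p-norms *)

Section Norms.
Variable R : realType.

Lemma pnorm_ge0 (p : R) n (v : 'I_n -> R) : 0 <= pnorm p v.
Proof. exact: powR_ge0. Qed.

Lemma sum_abs_powR_ge0 (p : R) n (v : 'I_n -> R) : 0 <= \sum_(j < n) `|v j| `^ p.
Proof. by apply: sumr_ge0 => j _; exact: powR_ge0. Qed.

Lemma sum_abs_powR_gt0 (p : R) n (v : 'I_n -> R) j :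
  v j != 0 -> 0 < \sum_(j < n) `|v j| `^ p.
Proof.
move=> vj; rewrite (bigD1 j) //= ltr_wpDr ?powR_gt0 ?normr_gt0 //.
by apply: sumr_ge0 => i _; exact: powR_ge0.
Qed.

Lemma pnorm_gt0 (p : R) n (v : 'I_n -> R) j : v j != 0 -> 0 < pnorm p v.
Proof. by move=> vj; rewrite powR_gt0 // (sum_abs_powR_gt0 _ vj). Qed.

Lemma pnorm_powR (p : R) n (v : 'I_n -> R) : p != 0 ->
  pnorm p v `^ p = \sum_(j < n) `|v j| `^ p.
Proof. by move=> p0; rewrite -powRrM mulVf // powRr1 ?sum_abs_powR_ge0. Qed.

Lemma pnorm_eq1 (p : R) n (v : 'I_n -> R) : p != 0 ->
  pnorm p v = 1 <-> \sum_(j < n) `|v j| `^ p = 1.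
Proof.
move=> p0; split => [h|h]; last by rewrite /pnorm h powR1.
by rewrite -pnorm_powR // h powR1.
Qed.

Lemma pnorm_scale (p c : R) n (v : 'I_n -> R) : p != 0 ->
  pnorm p (fun j => c * v j) = `|c| * pnorm p v.
Proof.
move=> p0; rewrite /pnorm.
under eq_bigr do rewrite normrM powRM //.
by rewrite -mulr_sumr powRM ?powR_ge0 ?sum_abs_powR_ge0 // -powRrM divff // powRr1.
Qed.

Lemma eq_pnorm (p : R) n (v w : 'I_n -> R) :
  (forall j, `|v j| = `|w j|) -> pnorm p v = pnorm p w.
Proof. by move=> vw; rewrite /pnorm; under eq_bigr do rewrite vw. Qed.

Lemma pnorm1_ex_neq0 (p : R) n (v : 'I_n -> R) : p != 0 ->
  pnorm p v = 1 -> exists j, v j != 0.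
Proof.
move=> p0 /(pnorm_eq1 _ p0) v1; apply: contrapT => /forallNP v0.
move: v1; rewrite big1 => [/eqP|j _]; first by rewrite eq_sym oner_eq0.
by have /negP/negPn/eqP -> := v0 j; rewrite normr0 powR0.
Qed.

End Norms.

(** * Critical points of the Rayleigh quotient *)

Section Quotient.
Variables (R : realType) (m : nat) (d : 'I_m -> nat).
Variables (f : tensor R d) (p : 'I_m -> R).
Hypothesis p_gt1 : forall k, 1 < p k.
Implicit Types (x y : pt R d) (k : 'I_m).

Let p_gt0 k : 0 < p k. Proof. exact: lt_trans ltr01 (p_gt1 k). Qed.
Let p_neq0 k : p k != 0. Proof. by rewrite gt_eqF. Qed.

Lemma Qf_unit x : (forall k, pnorm (p k) (x k) = 1) -> Qf f p x = `|mform f x|.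
Proof. by move=> x1; rewrite /Qf big1 ?divr1. Qed.

Lemma unit_admissible x : (forall k, pnorm (p k) (x k) = 1) -> admissible x.
Proof. by move=> x1 k; exact: pnorm1_ex_neq0 (p_neq0 k) (x1 k). Qed.

Lemma prod_pnorm_scale (c : 'I_m -> R) x :
  \prod_(k < m) pnorm (p k) (fun j => c k * x k j) =
  `|\prod_(k < m) c k| * \prod_(k < m) pnorm (p k) (x k).
Proof.
rewrite normr_prod -big_split; apply: eq_bigr => k _; exact: pnorm_scale.
Qed.

Lemma Qf_scale (c : 'I_m -> R) x : (forall k, c k != 0) ->
  Qf f p (fun k j => c k * x k j) = Qf f p x.
Proof.
move=> c0.
rewrite (congr2 (fun a b => `|a| / b) (mform_scale f c x) (prod_pnorm_scale c x) : Qf _ _ _ = _).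
rewrite normrM -mulf_div divff ?mul1r //.
by rewrite normr_eq0; apply/prodf_neq0 => k _.
Qed.

Lemma prod_shift (N : forall l, ('I_(d l) -> R) -> R) x k (j : nat) t :
  \prod_(l < m) N l (Defs.shift x k j t l) =
  (\prod_(l < m | l != k) N l (x l)) * N k (Defs.shift x k j t k).
Proof.
rewrite (bigD1 k) //= mulrC; congr (_ * _); apply: eq_bigr => l lk; congr (N l _).
by apply: funext => u; rewrite /Defs.shift (negbTE lk) /= addr0.
Qed.

Lemma sum_abs_powR_shift x k (j : 'I_(d k)) t :
  \sum_(u < d k) `|Defs.shift x k j t k u| `^ p k =
  \sum_(u < d k | u != j) `|x k u| `^ p k + `|x k j + t| `^ p k.
Proof.
rewrite (bigD1 j) //= addrC /Defs.shift !eqxx /=; congr (_ + _).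
by apply: eq_bigr => u uj; rewrite -[val _ == _]/(u == j) (negbTE uj) addr0.
Qed.

Lemma Qf_shift x k (j : 'I_(d k)) t :
  Qf f p (Defs.shift x k j t) =
  `|mform f x + t * mpartial f k j x| /
   ((\prod_(l < m | l != k) pnorm (p l) (x l)) *
     (\sum_(u < d k | u != j) `|x k u| `^ p k + `|x k j + t| `^ p k) `^ (p k)^-1).
Proof.
have h := prod_shift (fun l v => pnorm (p l) v) x k j t.
exact: (congr2 (fun a b => `|a| / b) (mform_shift f x k j t)
  (etrans h (congr1 (fun s => _ * s `^ _) (sum_abs_powR_shift x j t)))).
Qed.

Lemma is_derive_Qf_shift x k (j : 'I_(d k)) t :
    admissible x -> 0 <= x k j + t -> (exists u, Defs.shift x k j t k u != 0) ->
    0 < mform f (Defs.shift x k j t) ->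
  exists D, is_derive t 1 (fun u => Qf f p (Defs.shift x k j u)) D.
Proof.
move=> adm xt [u xu] F0.
rewrite (funext (Qf_shift x j)); eexists; apply: is_derive_quotient => //.
- by apply: prodr_gt0 => l _; have [v xv] := adm l; exact: pnorm_gt0 xv.
- by have := sum_abs_powR_gt0 (p k) xu; rewrite sum_abs_powR_shift.
- by rewrite -mform_shift.
Qed.

(** The factor [c] is the inverse of the product of the norms. Only its sign is recorded, since what
    matters is where the derivative vanishes. *)
Lemma is_derive_Qf x k (j : 'I_(d k)) :
    admissible x -> 0 <= x k j -> 0 < mform f x ->
  exists2 c : R, 0 < c & is_derive (0 : R) 1 (fun u => Qf f p (Defs.shift x k j u))
    (c * (mpartial f k j x - mform f x * x k j `^ (p k - 1) /
           \sum_(j' < d k) `|x k j'| `^ p k)).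
Proof.
move=> adm x0 F0.
have S0 : 0 < \sum_(j' < d k) `|x k j'| `^ p k.
  by have [u xu] := adm k; exact: sum_abs_powR_gt0 xu.
have SE : \sum_(j' < d k) `|x k j'| `^ p k =
    \sum_(j' < d k | j' != j) `|x k j'| `^ p k + `|x k j| `^ p k.
  by rewrite (bigD1 j) //= addrC.
have P0 : 0 < \prod_(l < m | l != k) pnorm (p l) (x l).
  by apply: prodr_gt0 => l _; have [v xv] := adm l; exact: pnorm_gt0 xv.
set P := \prod_(l < m | l != k) _ in P0.
exists (P * (\sum_(j' < d k) `|x k j'| `^ p k) `^ (p k)^-1)^-1.
  by rewrite invr_gt0 mulr_gt0 ?powR_gt0.
rewrite (funext (Qf_shift x j)).
have := @is_derive_quotient _ (p k) P (x k j)
  (\sum_(j' < d k | j' != j) `|x k j'| `^ p k) (mform f x) (mpartial f k j x) 0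
  (p_gt1 k) P0.
rewrite addr0 mul0r addr0 -SE => /(_ x0 S0 F0) h.
by apply: is_derive_eq h _; rewrite mulrC.
Qed.

(** Differentiability is automatic here, even at zero entries, so criticality amounts to the
    Euler-Lagrange equations. They are stated without normalizing [x]. *)
Lemma singular_vectorP x : (forall k j, 0 <= x k j) -> admissible x ->
    0 < mform f x ->
  (forall (k : 'I_m) (j : 'I_(d k)),
    derivable (fun t => Qf f p (Defs.shift x k j t)) 0 1 /\
    pderiv (Qf f p) k j x = 0) <->
  (forall k (j : 'I_(d k)), mpartial f k j x =
     mform f x * x k j `^ (p k - 1) / \sum_(j' < d k) `|x k j'| `^ p k).
Proof.
move=> x0 adm F0; split => h k j.
  have [c c0 der] := is_derive_Qf adm (x0 k j) F0.
  have [_ /eqP] := h k j; rewrite /pderiv derive1E (@derive_val _ _ _ _ _ _ _ der).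
  by rewrite mulf_eq0 gt_eqF //= subr_eq0 => /eqP.
have [c c0 der] := is_derive_Qf adm (x0 k j) F0.
split; first exact: ex_derive.
by rewrite /pderiv derive1E (@derive_val _ _ _ _ _ _ _ der) h subrr mulr0.
Qed.

Hypothesis f_ge0 : nonneg_tensor f.

Lemma Qf_max_critical x (J : midx d) : 0 < f J ->
    (forall k j, 0 < x k j) ->
    (forall y, admissible y -> Qf f p y <= Qf f p x) ->
  forall k (j : 'I_(d k)), mpartial f k j x =
     mform f x * x k j `^ (p k - 1) / \sum_(j' < d k) `|x k j'| `^ p k.
Proof.
move=> fJ x0 xmax k j.
have adm : admissible x by move=> l; exists (J l); rewrite gt_eqF.
have F0 : 0 < mform f x.
  by apply: (mform_gt0 f_ge0 _ fJ) => // l u; exact: ltW.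
have shift_gt0 t : - x k j < t -> forall l u, 0 < Defs.shift x k j t l u.
  move=> xt l u; rewrite /Defs.shift; case: ifP => [/andP[/eqP lk]|_]; last first.
    by rewrite addr0.
  case: _ / (esym lk) u => u /eqP uj; have -> : u = j by apply: val_inj.
  by rewrite addrC -ltrBlDr sub0r.
have [c c0 der] := is_derive_Qf adm (ltW (x0 k j)) F0.
have der0 : is_derive (0 : R) 1 (fun u => Qf f p (Defs.shift x k j u)) 0.
  (* For [t > - x k j] the shifted point stays positive, so the quotient is differentiable on the
     whole interval and has its maximum at the interior point [0]. *)
  apply: (@derive1_at_max _ _ (- x k j) (x k j)).
  - by rewrite ge0_cp ?ltW.
  - move=> t; rewrite in_itv /= => /andP[/shift_gt0 st _].
    suff [D dt] : exists D, is_derive t 1 (fun u => Qf f p (Defs.shift x k j u)) D.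
      exact: (@ex_derive _ _ _ _ _ _ _ dt).
    apply: is_derive_Qf_shift => //.
    + by have := st k j; rewrite /Defs.shift !eqxx /= => /ltW.
    + by exists (J k); rewrite gt_eqF.
    + by apply: (mform_gt0 f_ge0 _ fJ) => // l u; exact: ltW.
  - by rewrite in_itv /= oppr_lt0 x0.
  - move=> t; rewrite in_itv /= => /andP[/shift_gt0 st _].
    have -> : Defs.shift x k j 0 = x.
      apply: functional_extensionality_dep => l; apply: funext => u.
      by rewrite /Defs.shift if_same addr0.
    by apply: xmax => l; exists (J l); rewrite gt_eqF.
have := @derive_val _ _ _ _ _ _ _ der; rewrite (@derive_val _ _ _ _ _ _ _ der0).
move=> /esym /eqP; rewrite mulf_eq0 gt_eqF //= subr_eq0 => /eqP //.
Qed.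

End Quotient.

(** * Existence of a nonnegative maximizer by compactness *)

Section RowCoordinates.
Variables (R : realType) (m : nat) (d : 'I_m -> nat).

(** Points are flattened to row vectors indexed by the pairs [(k, j)], a space where a product of
    segments is compact. *)
Definition pt_of_row (v : 'rV[R]_#|{: vert d}|) : pt R d :=
  fun k j => v ord0 (enum_rank (Tagged (fun k => 'I_(d k)) j : vert d)).

Definition row_of_pt (x : pt R d) : 'rV[R]_#|{: vert d}| :=
  \row_i x (tag (enum_val i)) (tagged (enum_val i)).

End RowCoordinates.
Arguments pt_of_row {R m d} v _ _.

Lemma row_of_ptK (R : realType) (m : nat) (d : 'I_m -> nat) (x : pt R d) k j :
  pt_of_row (row_of_pt x) k j = x k j.
Proof. by rewrite /pt_of_row mxE enum_rankK. Qed.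

Section Existence.
Variables (R : realType) (m : nat) (d : 'I_m -> nat).
Variables (f : tensor R d) (p : 'I_m -> R).
Hypothesis p_gt1 : forall k, 1 < p k.
Hypothesis f_ge0 : nonneg_tensor f.
Implicit Types (x y : pt R d) (k : 'I_m).

Let p_gt0 k : 0 < p k. Proof. exact: lt_trans ltr01 (p_gt1 k). Qed.
Let p_neq0 k : p k != 0. Proof. by rewrite gt_eqF. Qed.

(** The nonnegative part of the product of unit spheres. The upper bound [1] on the entries follows
    from the norms; stating it exhibits a closed subset of a compact box. *)
Definition unit_row_set : set 'rV[R]_#|{: vert d}| :=
  [set v : 'rV[R]_#|{: vert d}| | forall i, v ord0 i \in `[0, 1]%R] `&`
  \bigcap_(k in [set: 'I_m])
    [set v : 'rV[R]_#|{: vert d}| | \sum_(j < d k) `|pt_of_row v k j| `^ p k = 1].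

Lemma compact_unit_row_set : compact unit_row_set.
Proof.
apply: compact_closedI.
  apply: (@rV_compact R _ (fun=> [set` `[0, 1]%R])) => _; exact: (@segment_compact R 0 1).
apply: closed_bigI => k _.
apply: (@closed_comp _ _ (fun v => \sum_(j < d k) `|pt_of_row v k j| `^ p k) [set 1]).
  move=> v _; apply: continuous_sum_fun => j {}v.
  apply: (@continuous_comp _ _ _ (fun v => pt_of_row v k j) (fun u => `|u| `^ p k)).
    exact: coord_continuous.
  exact: continuous_abs_powR.
exact: closed_eq.
Qed.

Lemma continuous_mform_row : continuous (fun v => mform f (pt_of_row v)).
Proof.
apply: continuous_sum_fun => J v; apply: continuousM; first exact: cst_continuous.
by apply: continuous_prod_fun => k {}v; exact: coord_continuous.
Qed.

Lemma mem_unit_row_set x : (forall k j, 0 <= x k j) ->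
  (forall k, pnorm (p k) (x k) = 1) -> unit_row_set (row_of_pt x).
Proof.
move=> x0 x1; have S1 k : \sum_(j < d k) `|x k j| `^ p k = 1.
  exact/pnorm_eq1.
split => [i|k _] /=; last first.
  by under eq_bigr do rewrite row_of_ptK; exact: S1.
rewrite mxE in_itv /= x0 /=; set k := tag _; set j := tagged _.
have : `|x k j| `^ p k <= 1.
  rewrite -(S1 k) (bigD1 j) //= lerDl.
  by apply: sumr_ge0 => u _; exact: powR_ge0.
rewrite ger0_norm // leNgt; apply: contraTT; rewrite -!ltNge => x_gt1.
rewrite -(powRr0 (x k j)) /powR gt_eqF ?(lt_trans ltr01) //.
by rewrite ltr_expR mul0r mulr_gt0 // ln_gt0.
Qed.

Lemma ler_Qf_abs y : Qf f p y <= Qf f p (fun k j => `|y k j|).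
Proof.
rewrite /Qf [X in _ <= _ / X](_ : _ = \prod_(k < m) pnorm (p k) (y k)).
  rewrite ler_wpM2r ?invr_ge0 //; last first.
    by rewrite (le_trans (ler_norm_mform f_ge0 y)) ?ler_norm.
  by apply: prodr_ge0 => k _; exact: pnorm_ge0.
by apply: eq_bigr => k _; apply: eq_pnorm => j; rewrite normr_id.
Qed.

(** Passing to absolute values does not lower [Q], and rescaling blocks leaves it unchanged. Every
    admissible point is thus dominated by one of the compact set, where [Q] is the continuous
    function [mform f]. *)
Lemma exists_Qf_max : (forall k, (0 < d k)%N) ->
  exists x, [/\ forall k j, 0 <= x k j, forall k, pnorm (p k) (x k) = 1 &
    forall y, admissible y -> Qf f p y <= Qf f p x].
Proof.
move=> d0.
have ne : unit_row_set !=set0.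
  exists (row_of_pt (unit_block 0)); apply: mem_unit_row_set => [k j|k].
    by rewrite /unit_block ler0n.
  apply/pnorm_eq1 => //; rewrite (bigD1 (Ordinal (d0 k))) //= big1 => [|j jk].
    by rewrite /unit_block /= normr1 powR1 addr0.
  rewrite /unit_block (_ : (val j == 0) = false) ?normr0 ?powR0 //.
  by apply: contra_neqF jk => /eqP j0; apply: val_inj.
have [|c cA cmax] := compact_EVT_max ne compact_unit_row_set
  (_ : {within unit_row_set, continuous (fun v => mform f (pt_of_row v))}).
  by apply: continuous_subspaceT => v; exact: continuous_mform_row.
move: cA; rewrite inE => -[c01 cS].
have c0 k j : 0 <= pt_of_row c k j.
  have := c01 (enum_rank (Tagged (fun k => 'I_(d k)) j : vert d)).
  by rewrite /= in_itv /= => /andP[].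
have c1 k : pnorm (p k) (pt_of_row c k) = 1 by apply/pnorm_eq1 => //; exact: cS.
exists (pt_of_row c); split; [exact: c0|exact: c1|move=> y adm].
have N0 k : 0 < pnorm (p k) (y k).
  by have [j yj] := adm k; exact: pnorm_gt0 yj.
have NV k : (pnorm (p k) (y k))^-1 != 0 by rewrite invr_eq0 gt_eqF.
apply: le_trans (ler_Qf_abs y) _.
rewrite -(Qf_scale f p_gt1 _ NV); set z := (fun k j => _ * _).
have z0 k j : 0 <= z k j by rewrite mulr_ge0 // invr_ge0 ltW.
have z1 k : pnorm (p k) (z k) = 1.
  rewrite /z pnorm_scale // (@eq_pnorm _ _ _ _ (y k)).
    by rewrite gtr0_norm ?invr_gt0 // mulVf // gt_eqF.
  by move=> j; rewrite normr_id.
rewrite !Qf_unit // !ger0_norm ?mform_ge0 //.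
have := cmax (row_of_pt z); rewrite inE => /(_ (mem_unit_row_set z0 z1)).
by rewrite (eq_mform f (row_of_ptK z)).
Qed.

End Existence.

(** * Positivity of the maximizer *)

Lemma connect_invariant (T : finType) (e : rel T) (A : T -> Prop) :
  (forall u v, e u v -> A u -> A v) -> forall u v, connect e u v -> A u -> A v.
Proof.
move=> eA u v /connectP[s + ->]; elim: s u => [|w s IH] u //= /andP[uw ws] Au.
exact: IH ws (eA _ _ uw Au).
Qed.

Lemma prod_powR (R : realType) (I : finType) (P : pred I) (e : R) (F : I -> R) :
  0 < e -> \prod_(i | P i) e `^ F i = e `^ (\sum_(i | P i) F i).
Proof.
move=> e0; rewrite (big_morph (powR e) (id1 := 1) (op1 := *%R)) ?powRr0 //.
by move=> a b; rewrite powRD // (gt_eqF e0) implybT.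
Qed.

Lemma powR_prod (R : realType) (I : finType) (P : pred I) (F : I -> R) (r : R) :
  (forall i, 0 <= F i) ->
  (\prod_(i | P i) F i) `^ r = \prod_(i | P i) F i `^ r.
Proof.
move=> F0; suff [] : 0 <= \prod_(i | P i) F i /\
  (\prod_(i | P i) F i) `^ r = \prod_(i | P i) F i `^ r by [].
elim/big_ind2: _ => [|a b u v [a0 ab] [u0 uv]|i _]; rewrite ?powR1 //.
by rewrite powRM // ab uv mulr_ge0.
Qed.

Lemma powR_dominates_linear (R : realType) (a B c : R) : 0 < c -> a < 1 ->
  exists2 e, 0 < e & B * e < c * e `^ a.
Proof.
move=> c0 a1; have a0 : 1 - a != 0 by rewrite subr_eq0 gt_eqF.
have B1 : 0 < `|B| + 1 by rewrite ltr_wpDl.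
(* This [e] solves [e ^ (1 - a) = c / (|B| + 1)], hence [B * e = B * c / (|B| + 1) * e ^ a]. The
   added [1] makes the bound strict and the denominator nonzero. *)
exists ((c / (`|B| + 1)) `^ (1 - a)^-1); first by rewrite powR_gt0 ?divr_gt0.
set e := _ `^ _; have e0 : 0 < e by rewrite powR_gt0 ?divr_gt0.
have ee : e = e `^ (1 - a) * e `^ a.
  by rewrite -powRD ?subrK ?powRr1 ?ltW // (gt_eqF e0) implybT.
have e1a : e `^ (1 - a) = c / (`|B| + 1).
  by rewrite -powRrM mulVf // powRr1 // ltW // divr_gt0.
rewrite [X in B * X < _]ee e1a mulrA (ltr_pM2r (powR_gt0 _ e0)) mulrA ltr_pdivrMr // mulrC.
by rewrite ltr_pM2l // (le_lt_trans (ler_norm B)) // ltrDl.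
Qed.

Section Positivity.
Variables (R : realType) (m : nat) (d : 'I_m -> nat).
Variables (f : tensor R d) (p : 'I_m -> R).
Hypothesis p_gt1 : forall k, 1 < p k.
Hypothesis sum_p : \sum_(k < m) (p k)^-1 <= 1.
Hypothesis f_irr : weakly_irreducible f.
Implicit Types (x y : pt R d) (k : 'I_m).

Let p_gt0 k : 0 < p k. Proof. exact: lt_trans ltr01 (p_gt1 k). Qed.
Let p_neq0 k : p k != 0. Proof. by rewrite gt_eqF. Qed.
Let f_ge0 : nonneg_tensor f. Proof. by case: f_irr. Qed.

(** All other monomials can only grow, while the monomial [J] starts from zero, so its whole new
    value is gained. *)
Lemma ler_mformD x y (J : midx d) : (forall k j, 0 <= x k j <= y k j) ->
  \prod_(k < m) x k (J k) = 0 ->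
  mform f x + f J * \prod_(k < m) y k (J k) <= mform f y.
Proof.
move=> xy xJ; rewrite /mform (bigD1 J) //= xJ mulr0 add0r.
rewrite [leRHS](bigD1 J) //= addrC lerD2r; apply: ler_sum => I _.
by rewrite ler_wpM2l // ler_prod.
Qed.

(* Raising the zero entries of a maximizer to [e `^ (p k)^-1] costs [O(e)] in the
   norms, but gains a multiple of [e `^ a] with [a < 1] in the form as soon as
   some index [J] of the support meets both zero and nonzero entries. *)
Lemma Qf_max_gt0 x : (forall k j, 0 <= x k j) ->
    (forall k, pnorm (p k) (x k) = 1) ->
    (forall y, admissible y -> Qf f p y <= Qf f p x) ->
  forall k j, 0 < x k j.
Proof.
move=> x0 x1 xmax k0 j0.
pose nz (v : vert d) := x (tag v) (tagged v) != 0.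
have [j1 xj1] := pnorm1_ex_neq0 (p_neq0 k0) (x1 k0).
suff : nz (Tagged (fun k => 'I_(d k)) j0) by rewrite /nz /= lt_def x0 andbT.
(* Each block has a nonzero entry and the graph is connected, so it is enough that being nonzero
   passes along edges. An edge from a nonzero [u] to a zero [v] supplies the index [J] that meets
   both kinds. *)
apply: (@connect_invariant _ (gadj f) nz _ _ _ (f_irr.2 (Tagged _ j1) _)) => //.
move=> u v /andP[_ /existsP[J /andP[/andP[/eqP Ju /eqP Jv] fJ]]] nu.
apply/negP => /eqP nv.
pose a := \sum_(k < m | x k (J k) == 0) (p k)^-1.
pose c := f J * \prod_(k < m | x k (J k) != 0) x k (J k).
pose n k := \sum_(j < d k) (x k j == 0)%:R : R.
pose B := mform f x * \sum_(k < m) (p k)^-1 * n k.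
have c0 : 0 < c.
  rewrite mulr_gt0 //; apply: prodr_gt0 => k xk; by rewrite lt_def xk x0.
(* The sum [a] omits the positive term of [tag u], where the entry of [J] is nonzero. *)
have a1 : a < 1.
  apply: lt_le_trans sum_p; rewrite [ltRHS](bigID (fun k => x k (J k) == 0)) /=.
  rewrite ltrDl (bigD1 (tag u)) /=; last by rewrite Ju.
  by rewrite ltr_wpDr ?invr_gt0 // sumr_ge0 // => k _; rewrite invr_ge0 ltW.
have [e e0] := powR_dominates_linear B c0 a1; apply/negP; rewrite -leNgt.
pose y k j := if x k j == 0 then e `^ (p k)^-1 else x k j.
have y0 k j : 0 < y k j.
  by rewrite /y; case: eqVneq => [_|xk]; rewrite ?powR_gt0 // lt_def xk x0.
have xy k j : 0 <= x k j <= y k j.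
  by rewrite x0 /y; case: eqVneq => [xk|_] /=; rewrite ?xk ?powR_ge0.
have yS k : \sum_(j < d k) `|y k j| `^ p k = 1 + e * n k.
  have /pnorm_eq1 <- // := x1 k; rewrite mulr_sumr -big_split.
  apply: eq_bigr => j _ /=; rewrite /y; case: eqVneq => [->|_].
    rewrite normr0 powR0 // add0r mulr1 ger0_norm ?powR_ge0 //.
    by rewrite -powRrM mulVf // powRr1 // ltW.
  by rewrite mulr0 addr0.
have n0 k : 0 <= n k by apply: sumr_ge0 => j _; rewrite ler0n.
have F0 := mform_ge0 f_ge0 x0.
have N0 : 0 < \prod_(k < m) pnorm (p k) (y k).
  by apply: prodr_gt0 => k _; rewrite (@pnorm_gt0 _ _ _ _ (J k)) // gt_eqF.
(* The norms are [(1 + e * n k) ^ (1 / p k)], so AM-GM bounds their product by an affine function of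
   [e]. *)
have Nle : \prod_(k < m) pnorm (p k) (y k) <= 1 + e * \sum_(k < m) (p k)^-1 * n k.
  under eq_bigr do rewrite /pnorm yS.
  have w0 k : 0 < 1 + e * n k by rewrite ltr_wpDr // mulr_ge0 // ltW.
  have pV k : 0 < (p k)^-1 by rewrite invr_gt0.
  apply: le_trans (weighted_amgm_powR pV sum_p w0).1 _.
  rewrite le_eqVlt; apply/orP; left; apply/eqP.
  under eq_bigr do rewrite mulrDr mulr1 mulrCA.
  by rewrite big_split /= -mulr_sumr; ring.
have Qle : mform f y <= mform f x * \prod_(k < m) pnorm (p k) (y k).
  have := xmax y (fun k => ex_intro _ (J k) (lt0r_neq0 (y0 k (J k)))).
  rewrite (Qf_unit f x1) /Qf ler_pdivrMr // !ger0_norm //.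
  by apply: mform_ge0 => // k j; exact: ltW.
have prodx : \prod_(k < m) x k (J k) = 0.
  by rewrite (bigD1 (tag v)) //= Jv nv mul0r.
have prody : f J * \prod_(k < m) y k (J k) = c * e `^ a.
  rewrite /c /a -prod_powR // (bigID (fun k => x k (J k) == 0)) /=.
  rewrite -mulrA [RHS](congr1 (fun t => f J * t) (mulrC _ _)).
  rewrite (eq_bigr (fun k => e `^ (p k)^-1)); last by move=> k xk; rewrite /y xk.
  congr (_ * (_ * _)); apply: eq_bigr => k /negbTE xk; by rewrite /y xk.
have := ler_mformD xy prodx; rewrite prody => h1.
have h2 := le_trans h1 (le_trans Qle (ler_wpM2l F0 Nle)).
by move: h2; rewrite mulrDr mulr1 lerD2l /B; move/le_trans; apply; rewrite mulrCA mulrC.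
Qed.

End Positivity.

(** * Critical points, maximality and uniqueness through Hölder's inequality *)

Section Uniqueness.
Variables (R : realType) (m : nat) (d : 'I_m -> nat).
Variables (f : tensor R d) (p : 'I_m -> R).
Hypothesis p_gt1 : forall k, 1 < p k.
Hypothesis sum_p : \sum_(k < m) (p k)^-1 <= 1.
Hypothesis f_irr : weakly_irreducible f.
Implicit Types (x y : pt R d) (k : 'I_m).

Let p_gt0 k : 0 < p k. Proof. exact: lt_trans ltr01 (p_gt1 k). Qed.
Let p_neq0 k : p k != 0. Proof. by rewrite gt_eqF. Qed.
Let f_ge0 : nonneg_tensor f. Proof. by case: f_irr. Qed.

Lemma Spp_sum x k : Spp p x -> \sum_(j < d k) x k j `^ p k = 1.
Proof.
move=> [x0 /(_ k)/(pnorm_eq1 _ (p_neq0 k)) <-].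
by apply: eq_bigr => j _; rewrite gtr0_norm.
Qed.

(** At a critical [x] the Hölder moments are [f(x)] times the sums of [y k j ^ p k], so [E k = 1] is
    allowed and [y] attains equality. The quotients [(y / x) ^ p] then agree along edges, hence on
    the connected graph, and the normalizations make their common value [1]. *)
Lemma critical_unique x y : Spp p x -> Spp p y -> 0 < mform f x ->
    (forall k (j : 'I_(d k)), mpartial f k j x = mform f x * x k j `^ (p k - 1)) ->
  mform f y = mform f x -> forall k j, y k j = x k j.
Proof.
move=> xS yS F0 crit; have [x0 _] := xS; have [y0 _] := yS.
have powE k j : (y k j / x k j) `^ p k = y k j `^ p k / x k j `^ p k.
  rewrite powRM ?invr_ge0 ?(ltW (y0 k j)) ?(ltW (x0 k j)) //.
  by rewrite powRV ?(ltW (x0 k j)).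
have xp0 k j : x k j `^ p k != 0 by rewrite gt_eqF ?powR_gt0.
have sumE k : \sum_(j < d k) (y k j / x k j) `^ p k * (x k j * mpartial f k j x)
    <= 1 * mform f x.
  rewrite mul1r -[leRHS]mul1r -(Spp_sum k yS) mulr_suml.
  apply: ler_sum => j _; rewrite powE crit.
  have -> : x k j * (mform f x * x k j `^ (p k - 1)) = mform f x * x k j `^ p k.
    by rewrite mulrCA mulr_powRB1 ?(ltW (x0 k j)).
  by rewrite mulrCA mulfVK // mulrC.
have [_] := hoelder_mform f_ge0 p_gt0 sum_p x0 y0 (fun k => ltr01) sumE.
rewrite big1 ?mulr1 => [|k _]; last by rewrite powR1.
move=> eqc /eqc h k j.
pose w (v : vert d) := (y (tag v) (tagged v) / x (tag v) (tagged v)) `^ p (tag v).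
have wc (j' : 'I_(d k)) : w (Tagged (fun k => 'I_(d k)) j') = w (Tagged (fun k => 'I_(d k)) j).
  apply: (@connect_invariant _ (gadj f)
    (fun v => w v = w (Tagged (fun k => 'I_(d k)) j)) _
    (Tagged (fun k => 'I_(d k)) j)) => // [u v|]; last exact: f_irr.2.
  move=> /andP[_ /existsP[J /andP[/andP[/eqP Ju /eqP Jv] fJ]]] <-.
  by rewrite /w -Ju -Jv; have := h J fJ (tag v) (tag u); rewrite !divr1.
have w1 : w (Tagged (fun k => 'I_(d k)) j) = 1.
  have := Spp_sum k yS; rewrite -(Spp_sum k xS).
  have -> : \sum_(j < d k) y k j `^ p k =
      w (Tagged (fun k => 'I_(d k)) j) * \sum_(j < d k) x k j `^ p k.
    rewrite mulr_sumr; apply: eq_bigr => j' _.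
    by rewrite -(wc j') /w /= powE mulfVK.
  by rewrite (Spp_sum k xS) mulr1.
have : y k j / x k j = 1.
  apply: (@powR_injective _ (p k)) => //; rewrite ?nnegrE ?divr_ge0 ?ltW //.
  by rewrite powR1.
by move=> /(congr1 ( *%R^~ (x k j))); rewrite /= mulfVK ?mul1r // gt_eqF.
Qed.

(** The same use of Hölder without normalizing [x]: the choice [E k = (S k)^-1] produces the norms
    in the denominator of [Q]. *)
Lemma critical_Qf_max x y : (forall k j, 0 < x k j) -> Spp p y -> 0 < mform f x ->
    (forall k (j : 'I_(d k)), mpartial f k j x =
       mform f x * x k j `^ (p k - 1) / \sum_(j' < d k) `|x k j'| `^ p k) ->
  mform f y <= Qf f p x.
Proof.
move=> x0 yS F0 crit; have [y0 y1] := yS.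
pose S k := \sum_(j < d k) `|x k j| `^ p k.
have S0 k : 0 < S k.
  have [j _] := pnorm1_ex_neq0 (p_neq0 k) (y1 k).
  by apply: (@sum_abs_powR_gt0 _ _ _ _ j); rewrite gt_eqF.
have SV0 k : 0 < (S k)^-1 by rewrite invr_gt0.
have sumE k : \sum_(j < d k) (y k j / x k j) `^ p k * (x k j * mpartial f k j x)
    <= (S k)^-1 * mform f x.
  rewrite -[leRHS]mul1r -[X in _ <= X * _](Spp_sum k yS) mulr_suml.
  apply: ler_sum => j _; rewrite crit -/(S k).
  have -> : x k j * (mform f x * x k j `^ (p k - 1) / S k) =
      (S k)^-1 * mform f x * x k j `^ p k.
    by rewrite -[in RHS](mulr_powRB1 (ltW (x0 k j)) (p_gt0 k)); ring.
  rewrite powRM ?invr_ge0 ?(ltW (y0 k j)) ?(ltW (x0 k j)) // powRV ?(ltW (x0 k j)) //.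
  by rewrite mulrCA mulfVK ?gt_eqF ?powR_gt0 // mulrC.
have [le _] := hoelder_mform f_ge0 p_gt0 sum_p x0 y0 SV0 sumE.
apply: le_trans le _; rewrite /Qf gtr0_norm // ler_pM2l // -prodfV.
by apply: ler_prod => k _; rewrite powR_ge0 powRV ?(ltW (S0 k)) /=.
Qed.

(** As there is a second block, some path leads from [(k, j)] to a vertex of it; its first edge
    comes from an index through [(k, j)]. This makes all partial derivatives positive at positive
    points. *)
Lemma weakly_irreducible_slice : (2 <= m)%N -> (forall k, (0 < d k)%N) ->
  forall k (j : 'I_(d k)), exists2 J : midx d, J k = j & 0 < f J.
Proof.
move=> m2 d0 k j.
have /card_gt0P[l] : (0 < #|predC1 k|)%N.
  by rewrite cardC1 card_ord -subn1 subn_gt0.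
rewrite inE => lk.
have /connectP[[|v s]] := f_irr.2 (Tagged (fun k => 'I_(d k)) j)
  (Tagged (fun k => 'I_(d k)) (Ordinal (d0 l))).
  move=> _ /(congr1 tag) /= lE.
  by rewrite lE eqxx in lk.
move=> /= /andP[/andP[_ /existsP[J /andP[/andP[/eqP Jk _] fJ]]] _] _.
by exists J.
Qed.

End Uniqueness.

(** * Finite extrema, conjugate exponents and the Collatz-Wielandt bounds *)

Section FiniteRange.
Variables (R : realType) (n : nat) (F : 'I_n -> R).

Lemma le_sup_range j : F j <= sup (range F).
Proof.
apply: ub_le_sup; last by exists j.
exists (\sum_(i < n) `|F i|) => _ [i _ <-].
rewrite (le_trans (ler_norm _)) // (bigD1 i) //= lerDl.
exact: sumr_ge0.
Qed.

Lemma inf_range_le j : inf (range F) <= F j.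
Proof.
apply: ge_inf; last by exists j.
exists (- \sum_(i < n) `|F i|) => _ [i _ <-].
rewrite lerNl (le_trans (ler_norm _)) // normrN (bigD1 i) //= lerDl.
exact: sumr_ge0.
Qed.

Lemma inf_range_ge0 (j : 'I_n) : (forall j, 0 <= F j) -> 0 <= inf (range F).
Proof.
by move=> F0; apply: lb_le_inf; [exists (F j); exists j | move=> _ [i _ <-]].
Qed.

Lemma range_cst (j : 'I_n) c : (forall j, F j = c) -> range F = [set c].
Proof.
move=> Fc; apply/seteqP; split => [_ [i _ <-]|_ ->] /=; first exact: Fc.
by exists j.
Qed.

End FiniteRange.

Section ConjugateExponent.
Variables (R : realType) (p : R).
Hypothesis p_gt1 : 1 < p.

Let p1_neq0 : p - 1 != 0. Proof. by rewrite subr_eq0 gt_eqF. Qed.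
Let p_neq0 : p != 0. Proof. by rewrite gt_eqF // (lt_trans ltr01). Qed.

Lemma conj_exp_subr1 : conj_exp p - 1 = (p - 1)^-1.
Proof. by rewrite /conj_exp; field. Qed.

Lemma conj_expM : (conj_exp p - 1) * p = conj_exp p.
Proof. by rewrite conj_exp_subr1 mulrC. Qed.

Lemma conj_expV : 1 - p^-1 = (conj_exp p)^-1.
Proof. by rewrite /conj_exp; field; rewrite p1_neq0. Qed.

Lemma conj_exp_gt0 : 0 < conj_exp p.
Proof. by rewrite divr_gt0 ?subr_gt0 // (lt_trans ltr01). Qed.

End ConjugateExponent.

(* The block [i] is replaced by the (unnormalized) maximizer of the linear form
   [f(x_1, .., -, .., x_m)] on the unit sphere. *)
Definition dual_block (R : realType) (m : nat) (d : 'I_m -> nat) (f : tensor R d)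
    (p : 'I_m -> R) (i : 'I_m) (x : pt R d) : pt R d :=
  replace_block x i (fun k u => mpartial f k u x `^ (conj_exp (p i) - 1)).
Arguments dual_block {R m d} f p i x _ _.

Section CollatzWielandt.
Variables (R : realType) (m : nat) (d : 'I_m -> nat).
Variables (f : tensor R d) (p : 'I_m -> R) (i : 'I_m).
Hypothesis p_gt1 : forall k, 1 < p k.
Hypothesis f_ge0 : nonneg_tensor f.
Hypothesis f_slice :
  forall k (j : 'I_(d k)), exists2 J : midx d, J k = j & 0 < f J.
Hypothesis d_gt0 : forall k, (0 < d k)%N.
Implicit Types (x y : pt R d) (k nu : 'I_m).

Let p_gt0 k : 0 < p k. Proof. exact: lt_trans ltr01 (p_gt1 k). Qed.
Let p_neq0 k : p k != 0. Proof. by rewrite gt_eqF. Qed.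
Let p1_neq0 k : p k - 1 != 0. Proof. by rewrite subr_eq0 gt_eqF. Qed.
Local Notation q := (conj_exp (p i)).
Local Notation dual_block := (dual_block f p i).

Lemma mpartial_pos x k (j : 'I_(d k)) : (forall l u, 0 < x l u) ->
  0 < mpartial f k j x.
Proof.
move=> x0; have [J Jk fJ] := f_slice j.
by rewrite -Jk; apply: mpartial_gt0 => // l u; exact: ltW.
Qed.

Lemma mform_pos x : (forall l u, 0 < x l u) -> 0 < mform f x.
Proof.
move=> x0; have [J _ fJ] := f_slice (Ordinal (d_gt0 i)).
by apply: (mform_gt0 f_ge0 _ fJ) => // l u; exact: ltW.
Qed.

Lemma dual_block_gt0 x k j : (forall l u, 0 < x l u) -> 0 < dual_block x k j.
Proof.
move=> x0; rewrite /dual_block /replace_block; case: eqP => // _.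
by rewrite powR_gt0 // mpartial_pos.
Qed.

Lemma dual_block_neq x k j : k != i -> dual_block x k j = x k j.
Proof. by rewrite /dual_block /replace_block => /negbTE ->. Qed.

Lemma dual_block_eq x j : dual_block x i j = mpartial f i j x `^ (q - 1).
Proof. by rewrite /dual_block /replace_block eqxx. Qed.

Lemma mpartial_dual_block x (j : nat) : mpartial f i j (dual_block x) = mpartial f i j x.
Proof. by apply: eq_mpartial => l u; exact: dual_block_neq. Qed.

Lemma mform_dual_block x : (forall l u, 0 < x l u) ->
  mform f (dual_block x) = \sum_(j < d i) mpartial f i j x `^ q.
Proof.
move=> x0; rewrite mform_replace_block; apply: eq_bigr => j _.
by rewrite mulrC mulr_powRB1 ?conj_exp_gt0 // ltW // mpartial_pos.
Qed.

(** The inner [psi] yields the dual block, so the sum in [sfun] is a partial derivative at the dual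
    point. The outer [psi] is the power [1 / (p nu - 1)], which the exponent [p nu - 1] cancels. *)
Lemma CW_ratio x nu (j : 'I_(d nu)) : (forall l u, 0 < x l u) -> nu != i ->
  (Defs.sfun f p i j x / x nu j) `^ (p nu - 1) =
  mpartial f nu j (dual_block x) / x nu j `^ (p nu - 1).
Proof.
move=> x0 nui.
have -> : Defs.sfun f p i j x = mpartial f nu j (dual_block x) `^ (p nu - 1)^-1.
  rewrite /Defs.sfun pderiv_mform.
  have -> : \sum_(ji < d i) psi (conj_exp (p i)) (pderiv (mform f) i ji x) *
      pderiv (mpartial f nu j) i ji x = mpartial f nu j (dual_block x).
    rewrite -mpartial_replace_block //; apply: eq_bigr => ji _.
    rewrite pderiv_mpartial // pderiv_mform /psi.
    have D0 := mpartial_pos ji x0.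
    by rewrite gtr0_sg // mul1r gtr0_norm.
  have D0 := mpartial_pos j (fun l u => dual_block_gt0 u x0).
  by rewrite /psi gtr0_sg // mul1r gtr0_norm // conj_exp_subr1.
have D0 := ltW (mpartial_pos j (fun l u => dual_block_gt0 u x0)).
rewrite powRM ?powR_ge0 ?invr_ge0 ?(ltW (x0 _ _)) //.
by rewrite -powRrM mulVf // powRr1 // powRV // ltW.
Qed.

(** Euler's identity in block [nu]. On the unit sphere the weights [x nu j ^ p nu] add up to one,
    which places the right-hand side between the least and the greatest ratio. *)
Lemma sum_CW_ratio x nu : (forall l u, 0 < x l u) -> nu != i ->
  \sum_(j < d nu) x nu j `^ p nu * (mpartial f nu j (dual_block x) / x nu j `^ (p nu - 1))
  = mform f (dual_block x).
Proof.
move=> x0 nui; rewrite -(euler_mform f _ nu); apply: eq_bigr => j _.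
rewrite dual_block_neq // -(mulr_powRB1 (ltW (x0 nu j))) //.
have := powR_gt0 (p nu - 1) (x0 nu j); move=> /lt0r_neq0 xn.
by rewrite -mulrA (mulrC (x nu j `^ (p nu - 1))) mulfVK.
Qed.

Lemma CW_inf_le x nu : Spp p x -> nu != i ->
  inf (range (fun j : 'I_(d nu) => (Defs.sfun f p i j x / x nu j) `^ (p nu - 1)))
    <= mform f (dual_block x).
Proof.
move=> xS nui; have [x0 _] := xS.
set c := inf _; rewrite -(sum_CW_ratio x0 nui).
apply: (@le_trans _ _ (\sum_(j < d nu) x nu j `^ p nu * c)).
  by rewrite -mulr_suml (Spp_sum p_gt1 nu xS) mul1r.
apply: ler_sum => j _; rewrite ler_wpM2l ?powR_ge0 // -CW_ratio //.
exact: (inf_range_le (fun j : 'I_(d nu) => (Defs.sfun f p i j x / x nu j) `^ (p nu - 1))).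
Qed.

Lemma CW_sup_ge x nu : Spp p x -> nu != i ->
  mform f (dual_block x) <=
  sup (range (fun j : 'I_(d nu) => (Defs.sfun f p i j x / x nu j) `^ (p nu - 1))).
Proof.
move=> xS nui; have [x0 _] := xS.
set c := sup _; rewrite -(sum_CW_ratio x0 nui).
apply: (@le_trans _ _ (\sum_(j < d nu) x nu j `^ p nu * c)); last first.
  by rewrite -mulr_suml (Spp_sum p_gt1 nu xS) mul1r.
apply: ler_sum => j _; rewrite ler_wpM2l ?powR_ge0 // -CW_ratio //.
exact: (le_sup_range (fun j : 'I_(d nu) => (Defs.sfun f p i j x / x nu j) `^ (p nu - 1))).
Qed.

(** Let [g] be the value of the form at the dual point. Only block [i] is not normalized there, and
    the [p i]-th power of its norm is again [g]; hence [Q] equals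
    [g ^ (1 - 1 / p i) = g ^ (1 / q)]. *)
Lemma mform_dual_block_le x (lambda : R) : Spp p x ->
  (forall y, admissible y -> Qf f p y <= lambda) ->
  mform f (dual_block x) <= lambda `^ q.
Proof.
move=> xS maxl; have [x0 x1] := xS.
have g0 := mform_pos (fun l u => dual_block_gt0 u x0).
have adm : admissible (dual_block x).
  by move=> k; exists (Ordinal (d_gt0 k)); rewrite gt_eqF // dual_block_gt0.
have normE : pnorm (p i) (dual_block x i) = mform f (dual_block x) `^ (p i)^-1.
  rewrite /pnorm -(_ : \sum_(j < d i) `|dual_block x i j| `^ p i = mform f (dual_block x)).
    by [].
  rewrite (mform_dual_block x0); apply: eq_bigr => j _.
  by rewrite dual_block_eq ger0_norm ?powR_ge0 // -powRrM conj_expM.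
have prodE : \prod_(k < m) pnorm (p k) (dual_block x k) =
    mform f (dual_block x) `^ (p i)^-1.
  rewrite (bigD1 i) //= normE big1 ?mulr1 // => k ki.
  rewrite -(x1 k); apply: eq_pnorm => j; by rewrite dual_block_neq.
have := maxl _ adm; rewrite /Qf prodE gtr0_norm // => gl.
have gq : mform f (dual_block x) `^ q^-1 <= lambda.
  rewrite -conj_expV // powRB ?powRr1 ?(ltW g0) //.
  by rewrite (gt_eqF g0) implybT.
have q0 := conj_exp_gt0 (p_gt1 i).
rewrite -[leLHS]powRr1 ?(ltW g0) // -(mulVf (lt0r_neq0 q0)) powRrM.
by apply: ge0_ler_powR; rewrite ?nnegrE ?powR_ge0 ?(ltW q0) // (le_trans (powR_ge0 _ _) gq).
Qed.

Lemma prod_neq_cst (c : R) :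
  \prod_(nu < m | nu != i) c = c ^+ (m - 1).
Proof. by rewrite prodr_const cardC1 card_ord subn1. Qed.

Lemma CW_lower_le x (lambda : R) : Spp p x ->
  (forall y, admissible y -> Qf f p y <= lambda) ->
  CW_lower f p i x <= lambda `^ (q * (m - 1)%:R).
Proof.
move=> xS maxl; have [x0 _] := xS.
rewrite powRrM powR_mulrn ?powR_ge0 // -prod_neq_cst.
apply: ler_prod => nu nui; apply/andP; split.
  by apply: (inf_range_ge0 (Ordinal (d_gt0 nu))) => j; exact: powR_ge0.
exact: le_trans (CW_inf_le xS nui) (mform_dual_block_le xS maxl).
Qed.

(** Hölder from the dual point of [x] to [y] bounds [f(y)] by [g ^ (1 / q)] times powers of the
    quotients [b k / g >= 1], where [b k] is the greatest ratio in block [k]. *)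
Lemma CW_upper_ge x y : Spp p x -> Spp p y ->
    \sum_(k < m) (p k)^-1 <= 1 ->
    (forall k, k != i -> q * (m - 1)%:R <= p k) ->
  mform f y `^ (q * (m - 1)%:R) <= CW_upper f p i x.
Proof.
move=> xS yS sum_p hp; have [x0 _] := xS; have [y0 _] := yS.
set g := mform f (dual_block x).
have X0 k j := @dual_block_gt0 x k j x0.
have g0 : 0 < g := mform_pos X0.
pose b nu := sup (range (fun j : 'I_(d nu) => (Defs.sfun f p i j x / x nu j) `^ (p nu - 1))).
(* In block [i] the partial derivative equals the dual entry to the power [p i - 1], so the moment
   is [1 = g^-1 * g]. In the other blocks it is a weighted mean of ratios, at most [b k]. *)
pose E k := if k == i then g^-1 else b k / g.
have gb k : k != i -> g <= b k by exact: CW_sup_ge.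
have b0 k : k != i -> 0 < b k by move=> ki; exact: lt_le_trans (gb k ki).
have E0 k : 0 < E k.
  by rewrite /E; case: eqVneq => ki; rewrite ?invr_gt0 // divr_gt0 ?b0.
have sumE k : \sum_(j < d k) (y k j / dual_block x k j) `^ p k *
    (dual_block x k j * mpartial f k j (dual_block x)) <= E k * mform f (dual_block x).
  have powE j : (y k j / dual_block x k j) `^ p k =
      y k j `^ p k / (dual_block x k j * dual_block x k j `^ (p k - 1)).
    rewrite mulr_powRB1 ?(ltW (X0 k j)) // powRM ?invr_ge0 ?(ltW (y0 k j)) ?(ltW (X0 k j)) //.
    by rewrite powRV ?(ltW (X0 k j)).
  have termE j : (y k j / dual_block x k j) `^ p k *
      (dual_block x k j * mpartial f k j (dual_block x)) =
      y k j `^ p k * (mpartial f k j (dual_block x) / dual_block x k j `^ (p k - 1)).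
    rewrite powE; have /lt0r_neq0 := X0 k j.
    have /lt0r_neq0 := powR_gt0 (p k - 1) (X0 k j).
    move: (dual_block x k j) (_ `^ _) => u v un vn.
    by field; rewrite un vn.
  under eq_bigr do rewrite termE.
  rewrite /E; case: (eqVneq k i) => ki.
    rewrite mulVf ?gt_eqF // -[leRHS](Spp_sum p_gt1 k yS); apply: ler_sum => j _.
    rewrite -[leRHS]mulr1 ler_wpM2l ?powR_ge0 //.
    case: _ / (esym ki) j => j.
    rewrite mpartial_dual_block dual_block_eq -powRrM conj_exp_subr1 // mulVf //.
    have D0 := mpartial_pos j x0.
    by rewrite powRr1 ?(ltW D0) // divff ?gt_eqF.
  rewrite mulfVK ?gt_eqF //.
  apply: (@le_trans _ _ (\sum_(j < d k) y k j `^ p k * b k)); last first.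
    by rewrite -mulr_suml (Spp_sum p_gt1 k yS) mul1r.
  apply: ler_sum => j _; rewrite ler_wpM2l ?powR_ge0 // dual_block_neq // -CW_ratio //.
  exact: (le_sup_range (fun j : 'I_(d k) => (Defs.sfun f p i j x / x k j) `^ (p k - 1))).
have [le _] := hoelder_mform f_ge0 p_gt0 sum_p X0 y0 E0 sumE.
have q0 : 0 < q := conj_exp_gt0 (p_gt1 i).
have s0 : 0 <= q * (m - 1)%:R by rewrite mulr_ge0 ?(ltW q0) ?ler0n.
have F0 := mform_pos y0.
have prodE : mform f (dual_block x) * \prod_(k < m) E k `^ (p k)^-1 =
    g `^ q^-1 * \prod_(k < m | k != i) (b k / g) `^ (p k)^-1.
  rewrite (bigD1 i) //= mulrA; congr (_ * _).
    rewrite /E eqxx -conj_expV // powRB ?powRr1 ?(ltW g0) ?powRV ?(ltW g0) //.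
    by rewrite (gt_eqF g0) implybT.
  by apply: eq_bigr => k ki; rewrite /E (negbTE ki).
rewrite prodE in le.
(* Raising to the power [q * (m - 1)] turns [g ^ (1 / q)] into one factor [g] for each block other
   than [i]. *)
apply: (@le_trans _ _ ((g `^ q^-1 * \prod_(k < m | k != i) (b k / g) `^ (p k)^-1)
  `^ (q * (m - 1)%:R))).
  apply: ge0_ler_powR; rewrite ?nnegrE ?(ltW F0) //.
  exact: le_trans (ltW F0) le.
rewrite powRM ?powR_ge0 //; last by apply: prodr_ge0 => k _; exact: powR_ge0.
rewrite -powRrM mulrA mulVf ?(gt_eqF q0) // mul1r powR_mulrn ?(ltW g0) //.
rewrite -prod_neq_cst.
rewrite powR_prod => [|k]; last exact: powR_ge0.
rewrite -big_split /=; apply: ler_prod => k ki; apply/andP; split.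
  by rewrite mulr_ge0 ?powR_ge0 // ltW.
(* The base is at least one and the exponent [q * (m - 1) / p k] at most one, so the power is at
   most [b k / g], and the factor [g] cancels. *)
rewrite -powRrM; have b1 : 1 <= b k / g by rewrite ler_pdivlMr // mul1r gb.
have le1 : (p k)^-1 * (q * (m - 1)%:R) <= 1 by rewrite ler_pdivrMl // mulr1 hp.
by have := ler1_powR b1 le1; rewrite ler_pdivlMr // mulrC.
Qed.

(** At a critical point the dual block is block [i] of [x] scaled by [f(x) ^ (q - 1)], so every
    partial derivative in another block is scaled by the same factor. *)
Lemma CW_ratio_critical x nu (j : 'I_(d nu)) : (forall l u, 0 < x l u) -> nu != i ->
    (forall k (j : 'I_(d k)), mpartial f k j x = mform f x * x k j `^ (p k - 1)) ->
  (Defs.sfun f p i j x / x nu j) `^ (p nu - 1) = mform f x `^ q.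
Proof.
move=> x0 nui crit; rewrite CW_ratio //; have F0 := mform_pos x0.
pose c (l : 'I_m) := if l == i then mform f x `^ (q - 1) else 1.
have dualE l u : dual_block x l u = c l * x l u.
  rewrite /dual_block /replace_block /c; case: eqVneq => [li|_]; last first.
    by rewrite mul1r.
  rewrite crit -li powRM ?powR_ge0 ?(ltW F0) // -powRrM conj_exp_subr1 //.
  by rewrite divff // powRr1 // ltW.
have -> : mpartial f nu j (dual_block x) = mform f x `^ (q - 1) * mpartial f nu j x.
  have -> : mform f x `^ (q - 1) = \prod_(l < m) c l.
    by rewrite /c -big_mkcond big_pred1_eq.
  rewrite -mform_scale; apply: eq_mform => l u.
  rewrite /replace_block; case: eqVneq => [lnu|_]; last exact: dualE.
  by rewrite /c [l == i](_ : _ = false) ?mul1r // lnu (negbTE nui).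
rewrite crit mulrA mulfK ?gt_eqF ?powR_gt0 // mulrC.
by rewrite mulr_powRB1 ?conj_exp_gt0 // ltW.
Qed.

Lemma CW_critical x : (forall l u, 0 < x l u) ->
    (forall k (j : 'I_(d k)), mpartial f k j x = mform f x * x k j `^ (p k - 1)) ->
  CW_lower f p i x = mform f x `^ (q * (m - 1)%:R) /\
  CW_upper f p i x = mform f x `^ (q * (m - 1)%:R).
Proof.
move=> x0 crit; rewrite powRrM powR_mulrn ?powR_ge0 // -prod_neq_cst.
have rangeE nu : nu != i ->
    range (fun j : 'I_(d nu) => (Defs.sfun f p i j x / x nu j) `^ (p nu - 1)) =
    [set mform f x `^ q].
  move=> nui; apply: (range_cst (Ordinal (d_gt0 nu))) => j.
  exact: CW_ratio_critical.
by split; apply: eq_bigr => nu nui; rewrite rangeE // ?inf1 ?sup1.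
Qed.

End CollatzWielandt.

(** * Consequences of the condition on the exponents *)

Section Hypotheses.
Variables (R : realType) (m : nat) (p : 'I_m -> R) (i : 'I_m).
Hypothesis m_ge2 : (2 <= m)%N.
Hypothesis p_gt1 : forall k, 1 < p k.
Hypothesis hp : (m - 1)%:R <= (p i - 1) * (minp_except p i - (m - 1)%:R).

(** Expanding the hypothesis gives [(m - 1) * p i <= (p i - 1) * p k]. *)
Lemma conj_exp_le k : k != i -> conj_exp (p i) * (m - 1)%:R <= p k.
Proof.
move=> ki.
have min_le : minp_except p i <= p k.
  apply: ge_inf; last by exists k.
  by exists 1 => _ [l _ <-]; rewrite ltW.
have pi1 : 0 < p i - 1 by rewrite subr_gt0.
have : (m - 1)%:R <= (p i - 1) * (p k - (m - 1)%:R).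
  by apply: le_trans hp _; rewrite ler_pM2l // lerD2r.
rewrite /conj_exp mulrAC ler_pdivrMr //.
by move: (m - 1)%:R => M; nra.
Qed.

(** Each of the [m - 1] terms with [k != i] is at most [1 / (q * (m - 1))] for [q = conj_exp (p i)];
    together they stay below [1 / q = 1 - 1 / p i]. *)
Lemma sum_inv_exp_le1 : \sum_(k < m) (p k)^-1 <= 1.
Proof.
have M0 : 0 < (m - 1)%:R :> R by rewrite ltr0n subn_gt0.
have q0 := conj_exp_gt0 (p_gt1 i).
rewrite (bigD1 i) //= -lerBrDl conj_expV //.
apply: (@le_trans _ _ (\sum_(k < m | k != i) (conj_exp (p i) * (m - 1)%:R)^-1)).
  apply: ler_sum => k ki; rewrite lef_pV2 ?posrE ?(mulr_gt0 q0 M0) ?conj_exp_le //.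
  exact: lt_trans ltr01 (p_gt1 k).
rewrite sumr_const cardC1 card_ord -subn1 -[leLHS]mulr_natr invfM mulfVK //.
by rewrite gt_eqF.
Qed.

End Hypotheses.

(** * Attainment of the tensor norm, irreducible tensors and the assembly of the results *)

Lemma tnorm_max (R : realType) (m : nat) (d : 'I_m -> nat) (f : tensor R d)
    (p : 'I_m -> R) (x : pt R d) : admissible x ->
  (forall y, admissible y -> Qf f p y <= Qf f p x) -> tnorm f p = Qf f p x.
Proof.
move=> adm xmax; apply/eqP; rewrite eq_le; apply/andP; split.
  apply: ge_sup; first by exists (Qf f p x); exists x.
  by move=> _ [y yadm <-]; exact: xmax.
apply: ub_le_sup; last by exists x.
by exists (Qf f p x) => _ [y yadm <-]; exact: xmax.
Qed.

(** Irreducibility, applied to the zero set of [y], gives a zero vertex [u] and an index [J] of the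
    support through [u] whose other entries are nonzero. The partial derivative at [u] is then
    positive, while the critical equation makes it a multiple of [0 ^ (p - 1) = 0]. *)
Lemma irreducible_singular_gt0 (R : realType) (m : nat) (d : 'I_m -> nat)
    (f : tensor R d) (p : 'I_m -> R) (y : pt R d) :
  (0 < m)%N -> (forall k, 1 < p k) -> irreducible f -> (forall k j, 0 <= y k j) ->
  singular_vector f p y -> forall k j, 0 < y k j.
Proof.
move=> m0 p1 [f0 irr] y0 [adm [Fn0 sing]] k j.
have F0 : 0 < mform f y by rewrite lt_def Fn0 mform_ge0.
have /(singular_vectorP p1 y0 adm F0) crit := sing.
rewrite lt_def y0 andbT; apply/negP => yk.
pose Z := [set v : vert d | y (tag v) (tagged v) == 0]%SET.
have [||u [uZ [J [Ju [fJ Jl]]]]] := irr Z.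
- by apply/set0Pn; exists (Tagged (fun k => 'I_(d k)) j); rewrite inE.
- have [l yl] := adm (Ordinal m0).
  apply/negP => /eqP ZT.
  have : Tagged (fun k => 'I_(d k)) l \in Z by rewrite ZT inE.
  by rewrite inE /= (negbTE yl).
have : 0 < mpartial f (tag u) (J (tag u)) y.
  apply: mpartial_gt0 => // l /Jl; rewrite inE /= => yl.
  by rewrite lt_def yl y0.
rewrite crit Ju; move: uZ; rewrite inE => /eqP ->.
rewrite powR0 ?mulr0 ?mul0r ?ltxx //.
by rewrite subr_eq0 gt_eqF.
Qed.

Theorem theorem1 (R : realType) (m : nat) (d : 'I_m -> nat)
  (f : tensor R d) (p : 'I_m -> R) (i : 'I_m) :
  (2 <= m)%N ->
  (forall k, (0 < d k)%N) ->
  weakly_irreducible f ->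
  (forall k, 1 < p k) ->
  (m - 1)%:R <= (p i - 1) * (minp_except p i - (m - 1)%:R) ->
  (exists xs : pt R d,
     [/\ Spp p xs,
         Qf f p xs = tnorm f p,
         (forall y : pt R d, Spp p y -> Qf f p y = tnorm f p ->
            forall k j, y k j = xs k j),
         ((exists x, Spp p x /\
              CW_lower f p i x = tnorm f p `^ (conj_exp (p i) * (m - 1)%:R)) /\
          (forall x, Spp p x ->
              CW_lower f p i x <= tnorm f p `^ (conj_exp (p i) * (m - 1)%:R))) /\
         ((exists x, Spp p x /\
              CW_upper f p i x = tnorm f p `^ (conj_exp (p i) * (m - 1)%:R)) /\
          (forall x, Spp p x ->
              tnorm f p `^ (conj_exp (p i) * (m - 1)%:R) <= CW_upper f p i x)) &
         (irreducible f ->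
            (forall k j, 0 < xs k j) /\
            singular_vector f p xs /\
            forall y : pt R d, (forall k j, 0 <= y k j) -> singular_vector f p y ->
              exists c : 'I_m -> R, (forall k, 0 < c k) /\
                forall k j, y k j = c k * xs k j)]).
Proof.
move=> m2 d0 firr p1 hp.
have f0 : nonneg_tensor f by case: firr.
have sum_p := sum_inv_exp_le1 m2 p1 hp.
have slice := weakly_irreducible_slice firr m2 d0.
have [x [x_ge0 x1 xmax]] := exists_Qf_max p1 f0 d0.
have x0 := Qf_max_gt0 p1 sum_p firr x_ge0 x1 xmax.
have xS : Spp p x by [].
have adm := unit_admissible p1 x1.
have F0 : 0 < mform f x := mform_pos i f0 slice d0 x0.
have QF y : Spp p y -> Qf f p y = mform f y.
  move=> [y0 y1]; rewrite (Qf_unit f y1) gtr0_norm //.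
  exact: (mform_pos i f0 slice d0 y0).
have tE : tnorm f p = mform f x by rewrite (tnorm_max adm xmax) QF.
have [J _ fJ] := slice i (Ordinal (d0 i)).
have sing := Qf_max_critical p1 f0 fJ x0 xmax.
have crit k (j : 'I_(d k)) : mpartial f k j x = mform f x * x k j `^ (p k - 1).
  rewrite sing; have /pnorm_eq1 -> := x1 k; first by rewrite divr1.
  by rewrite gt_eqF // (lt_trans ltr01).
have maxl y : admissible y -> Qf f p y <= mform f x.
  by move=> /xmax; rewrite (QF x xS).
have uniq y : Spp p y -> Qf f p y = tnorm f p -> forall k j, y k j = x k j.
  move=> yS; rewrite QF // tE; exact: (critical_unique p1 sum_p firr xS yS F0 crit).
have [CWl CWu] := CW_critical i p1 f0 slice d0 x0 crit.
exists x; rewrite tE; split.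
- exact: xS.
- exact: QF.
- by move=> y yS; rewrite -tE; exact: uniq.
- split; split.
  + by exists x; split.
  + by move=> y yS; exact: (CW_lower_le i p1 f0 slice d0 yS maxl).
  + by exists x; split.
  + move=> y yS; apply: (CW_upper_ge p1 f0 slice d0 yS xS sum_p) => k.
    exact: conj_exp_le.
- move=> irr; split; first exact: x0.
  split; first by split=> //; split; [rewrite gt_eqF|exact/(singular_vectorP p1 x_ge0 adm F0)].
  move=> y y_ge0 ysing.
  have y0 := irreducible_singular_gt0 (ltnW m2) p1 irr y_ge0 ysing.
  have [yadm [_ /(singular_vectorP p1 y_ge0 yadm (mform_pos i f0 slice d0 y0)) ycrit]] := ysing.
  have N0 k : 0 < pnorm (p k) (y k).
    by have [j yj] := yadm k; exact: pnorm_gt0 yj.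
  have NV k : (pnorm (p k) (y k))^-1 != 0 by rewrite invr_eq0 gt_eqF.
  (* Normalizing each block keeps [Q], and a positive critical point maximizes [Q]; uniqueness then
     identifies [z] with [x], the scales being the norms of the blocks of [y]. *)
  pose z : pt R d := fun k j => (pnorm (p k) (y k))^-1 * y k j.
  have zS : Spp p z.
    split=> [k j|k]; first by rewrite mulr_gt0 ?invr_gt0.
    rewrite /z pnorm_scale; last by rewrite gt_eqF // (lt_trans ltr01).
    by rewrite gtr0_norm ?invr_gt0 // mulVf // gt_eqF.
  have zt : Qf f p z = tnorm f p.
    rewrite tE (Qf_scale f p1 y NV); apply/eqP; rewrite eq_le maxl //=.
    exact: (critical_Qf_max p1 sum_p firr y0 xS (mform_pos i f0 slice d0 y0) ycrit).
  exists (fun k => pnorm (p k) (y k)); split=> // k j.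
  by rewrite -(uniq z zS zt k j) /z mulVKf // gt_eqF.
Qed.
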